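(* Let $0<q<1$ and let $\alpha>0$ be real. Put $K=\mathbb{Z}_+^2$, endowed with the discrete topology. For $(l,m),(l',m'),(l'',m'')\in K$ define $$(\delta_{(l,m)}\star\delta_{(l',m')})((l'',m''))=a(l,m;l',m';l'',m''),$$ where the linearization coefficients $a(l,m;l',m';l'',m'')$ are determined by the expansion in $\mathcal{Z}$ $$R_{l,m}^{(\alpha)}(z,z^{*};q^2)\,R_{l',m'}^{(\alpha)}(z,z^{*};q^2)^{*}=\sum_{l'',m''\in\mathbb{Z}_+} a(l,m;l',m';l'',m'')\,R_{l'',m''}^{(\alpha)}(z,z^{*};q^2).$$ As an involution on $K$ take $(l,m)^{-}=(m,l)$. Furthermore write $e=(0,0)$. Then the quadruple $(K,\star,{}^{-},e)$ forms a non-commutative discrete DJS-hypergroup.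
   Context: $\mathbb{Z}_+=\{0,1,2,\dots\}$ and $0<q<1$ is fixed. For $k\in\mathbb{Z}_+$, $(a;q)_k=\prod_{j=0}^{k-1}(1-aq^j)$. $\mathcal{Z}$ is the complex unital $*$-algebra generated by elements $z$ and $z^{*}$ (with $(z)^{*}=z^{*}$) subject to the single relation $z^{*}z=q^2zz^{*}+1-q^2$; the set $\{z^k(z^{*})^l : k,l\in\mathbb{Z}_+\}$ is a linear basis of $\mathcal{Z}$. Little $q$-Jacobi polynomials in base $q^2$: for $m\in\mathbb{Z}_+$ and real $\alpha,\beta>-1$, $$P_m^{(\alpha,\beta)}(x;q^2)=\sum_{k=0}^m\frac{(q^{-2m};q^2)_k\,(q^{2(\alpha+\beta+m+1)};q^2)_k}{(q^{2(\alpha+1)};q^2)_k\,(q^2;q^2)_k}\,(q^2x)^k .$$ $q$-disk polynomials: for real $\alpha>-1$ and $l,m\in\mathbb{Z}_+$, $$R_{l,m}^{(\alpha)}(z,z^{*};q^2)=\begin{cases} z^{l-m}\,P_m^{(\alpha,l-m)}(1-zz^{*};q^2), & l\ge m,\\ P_l^{(\alpha,m-l)}(1-zz^{*};q^2)\,(z^{*})^{m-l}, & l\le m.\end{cases}$$ These elements, $l,m\in\mathbb{Z}_+$, form a linear basis of $\mathcal{Z}$, and $R_{l,m}^{(\alpha)}(z,z^{*};q^2)^{*}=R_{m,l}^{(\alpha)}(z,z^{*};q^2)$. For fixed $l,m,l',m'$ only finitely many of the coefficients $a(l,m;l',m';l'',m'')$ are non-zero. A measure on the discrete space $K$ is specified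 by its values at the points of $K$. DJS-hypergroup: Let $K$ be a locally compact Hausdorff space, $M(K)$ the space of complex regular Borel measures on $K$, $M^1(K)\subset M(K)$ the subset of probability measures, and $\delta_x$ the point measure at $x\in K$. Assume given (a) a convolution: a continuous map $K\times K\to M^1(K)$, $(x,y)\mapsto\delta_x\star\delta_y$, where $M^1(K)$ carries the weak topology with respect to $C_c(K)$; (b) an involution: an involutive homeomorphism $K\to K$, $x\mapsto\bar{x}$; (c) a unit element: a distinguished element $e\in K$. The convolution extends uniquely to a continuous bilinear map $M(K)\times M(K)\to M(K)$, $(\mu,\nu)\mapsto\mu\star\nu$, and the involution induces $\mu\mapsto\mu^{*}$ on $M(K)$ by $\mu^{*}(E)=\overline{\mu(\overline{E})}$ for Borel $E\subset K$, where $\overline{E}=\{\bar{x}:x\in E\}$. The quadruple $(K,\star,{}^{-},e)$ is a DJS-hypergroup if for all $x,y,w\in K$: (1) $\delta_x\star(\delta_y\star\delta_w)=(\delta_x\star\delta_y)\star\delta_w$; (2) $\mathrm{supp}(\delta_x\star\delta_y)$ is compact; (3) $(\delta_x\star\delta_y)^{*}=\delta_{\bar{y}}\star\delta_{\bar{x}}$; (4) $\delta_e\star\delta_x=\delta_x=\delta_x\star\delta_e$; (5) $e\in\mathrm{supp}(\delta_{\bar{x}}\star\delta_y)$ if and only if $x=y$; (6) the map $(x,y)\mapsto\mathrm{supp}(\delta_x\star\delta_y)$ from $K\times K$ to the space of nonvoid compact subsets of $K$ is continuous, the target carrying the topology with subbasis the sets $\{A: A\cap U\neq\emptyset,\ A\subset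 V\}$ for $U,V\subset K$ open. The hypergroup is commutative if $\delta_x\star\delta_y=\delta_y\star\delta_x$ for all $x,y\in K$, and non-commutative otherwise; it is discrete if $K$ is discrete.
   Formalization: The expansion is taken of R_{l,m} R_{l',m'} without the adjoint on the second factor: with the adjoint, δ_e⋆δ_{(1,0)} = δ_{(0,1)}, so e would not be a unit and the claim would fail. *)

(* Defs.v *)
From HB Require Import structures.
From mathcomp Require Import all_boot all_order all_algebra.
From mathcomp Require Import generic_quotient.
From mathcomp Require Import all_classical all_reals all_analysis.
From mathcomp Require Import complex.

Set Implicit Arguments.
Unset Strict Implicit.
Unset Printing Implicit Defensive.

Import Order.TTheory GRing.Theory Num.Theory.
Import numFieldNormedType.Exports.

Local Open Scope classical_set_scope.
Local Open Scope ring_scope.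
Local Open Scope quotient_scope.
Local Open Scope complex_scope.

Definition borel (K : ptopologicalType) := g_sigma_algebraType (@open K).

Section ProbabilityMeasures.
Context (R : realType) (K : ptopologicalType).

Definition regular_measure (mu : set (borel K) -> \bar R) :=
  forall E : set (borel K), measurable E ->
    mu E = ereal_inf [set mu U | U in [set U : set K | open U /\ E `<=` U]] /\
    mu E = ereal_sup [set mu C | C in [set C : set K | compact C /\ C `<=` E]].

Record regular_probability := RegularProbability {
  rprob :> probability (borel K) R;
  rprob_regular : regular_measure rprob }.

HB.instance Definition _ := gen_eqMixin regular_probability.
HB.instance Definition _ := gen_choiceMixin regular_probability.

(* Real-valued functions induce the same weak topology on probability measures
   as complex-valued ones. *)
Record Cc := CcFun {
  cc_fun :> K -> R;
  cc_continuous : continuous cc_fun;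
  cc_compact : compact (closure [set x | cc_fun x != 0]) }.

Definition pairing (mu : regular_probability) : {ptws Cc -> R} :=
  fun f => \int[rprob mu]_x f x.

HB.instance Definition _ :=
  Topological.copy regular_probability (initial_topology pairing).

(* Measures are total functions on [set K]; only their values on Borel sets are
   meaningful. *)
Definition measure_eq (mu nu : set (borel K) -> \bar R) :=
  forall E : set (borel K), measurable E -> mu E = nu E.

Definition msupp (mu : set (borel K) -> \bar R) : set K :=
  [set x | forall U : set K, open U -> U x -> (0 < mu U)%E].

End ProbabilityMeasures.

Section CompactSubsets.
Context (K : ptopologicalType).

Record compact_subset := CompactSubset {
  cset :> set K;
  cset_compact : compact cset;
  cset_nonvoid : cset !=set0 }.

HB.instance Definition _ := gen_eqMixin compact_subset.
HB.instance Definition _ := gen_choiceMixin compact_subset.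

Definition hit_and_inside (UV : set K * set K) : set compact_subset :=
  [set A : compact_subset | (A `&` UV.1 !=set0) /\ A `<=` UV.2].

HB.instance Definition _ := isSubBaseTopological.Build compact_subset
  [set UV : set K * set K | open UV.1 /\ open UV.2] hit_and_inside.

End CompactSubsets.

Section Hypergroup.
Context (R : realType) (K : ptopologicalType).
Variables (star : K -> K -> regular_probability R K) (inv : K -> K) (e : K).

(* The bilinear extension of [star] to measures.  The axioms only use it on
   probability measures, so complex measures are not needed. *)
Definition mconv (mu nu : {measure set (borel K) -> \bar R}) :
    set (borel K) -> \bar R :=
  fun E => (\int[mu]_x \int[nu]_y star x y E)%E.

(* On positive measures the complex conjugation in mu^* is vacuous. *)
Definition minv (mu : set (borel K) -> \bar R) : set (borel K) -> \bar R :=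
  fun E => mu (inv @` E).

Record DJS_hypergroup : Prop := {
  djs_locally_compact : locally_compact [set: K];
  djs_hausdorff : hausdorff_space K;
  djs_star_continuous : continuous (fun xy : K * K => star xy.1 xy.2);
  djs_inv_involutive : involutive inv;
  djs_inv_continuous : continuous inv;
  djs_assoc : forall x y w : K,
    measure_eq (mconv (@dirac _ (borel K) x R) (star y w))
               (mconv (star x y) (@dirac _ (borel K) w R));
  djs_supp_compact : forall x y, compact (msupp (star x y));
  djs_inv_star : forall x y,
    measure_eq (minv (star x y)) (star (inv y) (inv x));
  djs_unit : forall x,
    measure_eq (star e x) (@dirac _ (borel K) x R) /\
    measure_eq (star x e) (@dirac _ (borel K) x R);
  djs_unit_supp : forall x y, msupp (star (inv x) y) e <-> x = y;
  djs_supp_continuous : exists2 S : K * K -> compact_subset K,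
    forall x y, S (x, y) = msupp (star x y) :> set K & continuous S }.

Definition commutative_hypergroup :=
  forall x y, measure_eq (star x y) (star y x).

End Hypergroup.

Definition discrete_space (K : topologicalType) := forall A : set K, open A.

Section QDiskAlgebra.
Context (R : realType) (q : R).

Inductive zterm :=
  | ZConst of R[i] | ZGen | ZGenStar
  | ZAdd of zterm & zterm | ZMul of zterm & zterm.

(* The least congruence making [zterm] a unital algebra (the scalar [c] acting
   as multiplication by [ZConst c]) subject to
     z^* z = q^2 z z^* + 1 - q^2.
   This relation is self-adjoint, so presenting Z as a *-algebra with generator
   z or as an algebra with generators z and z^* yields the same algebra. *)
Inductive zcong : zterm -> zterm -> Prop :=
  | zcong_refl t : zcong t t
  | zcong_sym t u : zcong t u -> zcong u t
  | zcong_trans t u v : zcong t u -> zcong u v -> zcong t v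
  | zcong_add t t' u u' :
      zcong t t' -> zcong u u' -> zcong (ZAdd t u) (ZAdd t' u')
  | zcong_mul t t' u u' :
      zcong t t' -> zcong u u' -> zcong (ZMul t u) (ZMul t' u')
  | zcong_addA t u v : zcong (ZAdd t (ZAdd u v)) (ZAdd (ZAdd t u) v)
  | zcong_addC t u : zcong (ZAdd t u) (ZAdd u t)
  | zcong_add0 t : zcong (ZAdd (ZConst 0) t) t
  | zcong_mulA t u v : zcong (ZMul t (ZMul u v)) (ZMul (ZMul t u) v)
  | zcong_mul1 t : zcong (ZMul (ZConst 1) t) t
  | zcong_mul0 t : zcong (ZMul (ZConst 0) t) (ZConst 0)
  | zcong_mulDl t u v :
      zcong (ZMul (ZAdd t u) v) (ZAdd (ZMul t v) (ZMul u v))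
  | zcong_mulDr t u v :
      zcong (ZMul t (ZAdd u v)) (ZAdd (ZMul t u) (ZMul t v))
  | zcong_constD a b : zcong (ZConst (a + b)) (ZAdd (ZConst a) (ZConst b))
  | zcong_constM a b : zcong (ZConst (a * b)) (ZMul (ZConst a) (ZConst b))
  | zcong_central a t : zcong (ZMul (ZConst a) t) (ZMul t (ZConst a))
  | zcong_rel :
      zcong (ZMul ZGenStar ZGen)
            (ZAdd (ZMul (ZConst (q ^+ 2)%:C) (ZMul ZGen ZGenStar))
                  (ZConst (1 - q ^+ 2)%:C)).

HB.instance Definition _ := gen_eqMixin zterm.
HB.instance Definition _ := gen_choiceMixin zterm.

Definition zrel : rel zterm := fun t u => `[< zcong t u >].

Lemma zrel_equiv : equiv_class_of zrel.
Proof.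
split=> [t|t u|u t v].
- exact/asboolP/zcong_refl.
- by apply/asboolP/asboolP; exact: zcong_sym.
- by move=> /asboolP tu /asboolP uv; apply/asboolP/(zcong_trans tu uv).
Qed.

Canonical zrel_equivRel := EquivRelPack zrel_equiv.

Definition zalg := {eq_quot zrel_equivRel}.

HB.instance Definition _ := Choice.on zalg.

Definition zclass (t : zterm) : zalg := \pi_zalg t.

Lemma zclassP t u : zclass t = zclass u <-> zcong t u.
Proof. by split=> [/eqmodP/asboolP|tu]; [|apply/eqmodP/asboolP]. Qed.

Lemma zclass_repr (x : zalg) : zclass (repr x) = x.
Proof. exact: reprK. Qed.

Lemma repr_zclass t : zcong (repr (zclass t)) t.
Proof. by apply/zclassP; rewrite zclass_repr. Qed.

Definition zadd (x y : zalg) := zclass (ZAdd (repr x) (repr y)).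
Definition zmul (x y : zalg) := zclass (ZMul (repr x) (repr y)).
Definition zscale (a : R[i]) (x : zalg) := zmul (zclass (ZConst a)) x.
Definition zopp (x : zalg) := zscale (- 1) x.

Lemma zclassD t u : zadd (zclass t) (zclass u) = zclass (ZAdd t u).
Proof. by apply/zclassP; apply: zcong_add; exact: repr_zclass. Qed.

Lemma zclassM t u : zmul (zclass t) (zclass u) = zclass (ZMul t u).
Proof. by apply/zclassP; apply: zcong_mul; exact: repr_zclass. Qed.

Lemma zalg_ind (P : zalg -> Prop) : (forall t, P (zclass t)) -> forall x, P x.
Proof. by move=> Pz x; rewrite -(zclass_repr x). Qed.

Lemma zaddA : associative zadd.
Proof.
elim/zalg_ind=> t; elim/zalg_ind=> u; elim/zalg_ind=> v.
by rewrite !zclassD; apply/zclassP/zcong_addA.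
Qed.

Lemma zaddC : commutative zadd.
Proof.
elim/zalg_ind=> t; elim/zalg_ind=> u.
by rewrite !zclassD; apply/zclassP/zcong_addC.
Qed.

Lemma zadd0 : left_id (zclass (ZConst 0)) zadd.
Proof. by elim/zalg_ind=> t; rewrite zclassD; apply/zclassP/zcong_add0. Qed.

Lemma zmulA : associative zmul.
Proof.
elim/zalg_ind=> t; elim/zalg_ind=> u; elim/zalg_ind=> v.
by rewrite !zclassM; apply/zclassP/zcong_mulA.
Qed.

Lemma zmul1l : left_id (zclass (ZConst 1)) zmul.
Proof. by elim/zalg_ind=> t; rewrite zclassM; apply/zclassP/zcong_mul1. Qed.

Lemma zcentral a x : zmul (zclass (ZConst a)) x = zmul x (zclass (ZConst a)).
Proof.
by elim/zalg_ind: x => t; rewrite !zclassM; apply/zclassP/zcong_central.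
Qed.

Lemma zmul1r : right_id (zclass (ZConst 1)) zmul.
Proof. by move=> x; rewrite -zcentral zmul1l. Qed.

Lemma zmulDl : left_distributive zmul zadd.
Proof.
elim/zalg_ind=> t; elim/zalg_ind=> u; elim/zalg_ind=> v.
by rewrite !(zclassD, zclassM); apply/zclassP/zcong_mulDl.
Qed.

Lemma zmulDr : right_distributive zmul zadd.
Proof.
elim/zalg_ind=> t; elim/zalg_ind=> u; elim/zalg_ind=> v.
by rewrite !(zclassD, zclassM); apply/zclassP/zcong_mulDr.
Qed.

Lemma zconstD a b :
  zclass (ZConst (a + b)) = zadd (zclass (ZConst a)) (zclass (ZConst b)).
Proof. by rewrite zclassD; apply/zclassP/zcong_constD. Qed.

Lemma zconstM a b :
  zclass (ZConst (a * b)) = zmul (zclass (ZConst a)) (zclass (ZConst b)).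
Proof. by rewrite zclassM; apply/zclassP/zcong_constM. Qed.

Lemma zaddN : left_inverse (zclass (ZConst 0)) zopp zadd.
Proof.
move=> x; rewrite /zopp /zscale -[X in zadd _ X]zmul1l -zmulDl -zconstD addNr.
by elim/zalg_ind: x => t; rewrite zclassM; apply/zclassP/zcong_mul0.
Qed.

(* The character z, z^* |-> 1. *)
Fixpoint zeval1 (t : zterm) : R[i] :=
  match t with
  | ZConst a => a
  | ZGen | ZGenStar => 1
  | ZAdd t u => zeval1 t + zeval1 u
  | ZMul t u => zeval1 t * zeval1 u
  end.

Lemma zeval1_cong t u : zcong t u -> zeval1 t = zeval1 u.
Proof.
elim=> //= *; rewrite ?(addrA, mulrA, add0r, mul1r, mul0r, mulrDl, mulrDr) //.
all: try congruence.
- exact: addrC.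
- exact: mulrC.
- by rewrite !mulr1 rmorphB rmorph1 addrC subrK.
Qed.

Lemma zone_neq0 : zclass (ZConst 1) != zclass (ZConst 0).
Proof.
by apply/eqP => /zclassP/zeval1_cong /= /eqP; rewrite oner_eq0.
Qed.

HB.instance Definition _ := GRing.isZmodule.Build zalg zaddA zaddC zadd0 zaddN.
HB.instance Definition _ := GRing.Zmodule_isNzRing.Build zalg
  zmulA zmul1l zmul1r zmulDl zmulDr zone_neq0.

Lemma zscaleA a b (x : zalg) : zscale a (zscale b x) = zscale (a * b) x.
Proof. by rewrite /zscale zmulA -zconstM. Qed.

Lemma zscale1 : left_id 1 zscale.
Proof. exact: zmul1l. Qed.

Lemma zscaleDr : right_distributive zscale +%R.
Proof. by move=> a x y; rewrite /zscale; exact: zmulDr. Qed.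

Lemma zscaleDl (x : zalg) : {morph zscale^~ x : a b / a + b}.
Proof. by move=> a b; rewrite /zscale zconstD; exact: zmulDl. Qed.

HB.instance Definition _ := GRing.Zmodule_isLmodule.Build R[i] zalg
  zscaleA zscale1 zscaleDr zscaleDl.

Lemma zscaleAl (a : R[i]) (x y : zalg) : a *: (x * y) = (a *: x) * y.
Proof. exact: zmulA. Qed.

HB.instance Definition _ := GRing.Lmodule_isLalgebra.Build R[i] zalg zscaleAl.

Lemma zscaleAr (a : R[i]) (x y : zalg) : a *: (x * y) = x * (a *: y).
Proof.
change (zmul (zclass (ZConst a)) (zmul x y)
      = zmul x (zmul (zclass (ZConst a)) y)).
by rewrite [RHS]zmulA -zcentral zmulA.
Qed.

HB.instance Definition _ := GRing.Lalgebra_isAlgebra.Build R[i] zalg zscaleAr.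

Definition zgen : zalg := zclass ZGen.
Definition zgen_star : zalg := zclass ZGenStar.

Lemma zgen_rel : zgen_star * zgen =
  (q ^+ 2)%:C *: (zgen * zgen_star) + (1 - q ^+ 2)%:C *: 1.
Proof.
transitivity (zclass (ZAdd (ZMul (ZConst (q ^+ 2)%:C) (ZMul ZGen ZGenStar))
                           (ZConst (1 - q ^+ 2)%:C))).
  by rewrite -[LHS]/(zmul _ _) zclassM; apply/zclassP/zcong_rel.
rewrite -zclassD -!zclassM; congr (_ + _).
by rewrite -[RHS]/(zmul _ _) zmul1r.
Qed.

End QDiskAlgebra.

Section QDiskPolynomials.
Context (R : realType).

Definition qpoch (a p : R) (k : nat) : R := \prod_(j < k) (1 - a * p ^+ j).

(* P_m^(alpha,beta)(x; q^2): the parameter [q] is the square root of the base. *)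
Definition little_qJacobi (A : algType R[i]) (q alpha beta : R) (m : nat)
    (x : A) : A :=
  \sum_(k < m.+1)
    (qpoch (q ^- (2 * m)) (q ^+ 2) k
     * qpoch (q `^ (2 * (alpha + beta + m%:R + 1))) (q ^+ 2) k
     / (qpoch (q `^ (2 * (alpha + 1))) (q ^+ 2) k
        * qpoch (q ^+ 2) (q ^+ 2) k))%:C
    *: ((q ^+ 2)%:C *: x) ^+ k.

Definition qdisk (q alpha : R) (lm : nat * nat) : zalg q :=
  let: (l, m) := lm in
  let z := zgen q in
  let zs := zgen_star q in
  if (m <= l)%N
  then z ^+ (l - m) * little_qJacobi q alpha (l - m)%:R m (1 - z * zs)
  else little_qJacobi q alpha (m - l)%:R l (1 - z * zs) * zs ^+ (m - l).

(* An alias: [ptopologicalType] is not inferred on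
   [discrete_topology (nat * nat)] itself. *)
Definition qdisk_space := discrete_topology (nat * nat)%type.
HB.instance Definition _ :=
  Pointed.copy qdisk_space (discrete_topology (nat * nat)%type).
HB.instance Definition _ :=
  DiscreteTopology.copy qdisk_space (discrete_topology (nat * nat)%type).

(* [a] is the family of linearization coefficients.  There is no adjoint on the
   second factor: expanding R_x R_y^* instead would give
   delta_e * delta_y = delta_(inv y), so that e could not be a unit. *)
Definition qdisk_linearization (q alpha : R)
    (a : nat * nat -> nat * nat -> nat * nat -> R[i]) :=
  forall x y : nat * nat,
    finite_set [set w | a x y w != 0] /\
    qdisk q alpha x * qdisk q alpha y =
      \sum_(w \in [set w | a x y w != 0]) a x y w *: qdisk q alpha w.

End QDiskPolynomials.

(* Main.v *)
(* Let s be a square root of 1 - z z^* with s u = sigma(u) s for the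
   automorphism sigma : z |-> q z, z^* |-> q^-1 z^*.  Then

     Phi(z) = z (x) z (x) 1 + q s (x) s (x) z,
     Phi(z^* ) = z^* (x) z^* (x) 1 + q s (x) s (x) z^*

   defines an algebra morphism, and the q-disk polynomials satisfy an addition
   formula

     Phi(R_(m,n)^(alpha)) = sum_(k,l) c_(k,l) f_(k,l) (x) f_(k,l) (x) R_(k,l)^(alpha - 1),
     f_(k,l) = s^(k+l) R_(m-k,n-l)^(alpha + k + l),

   proved by induction on m and n from the recurrences for z R_(m,n) and
   z^* R_(m,n).  For alpha > 0 the c_(k,l) are positive, and so is the squared
   norm of R_(k,l)^(alpha - 1) under the functional h taking the coefficient of
   R_(0,0)^(alpha - 1), for which these polynomials are orthogonal.

   Let eps_w be the coefficient of R_w^(alpha).  Since f_(0,0) = R_(m,n)^(alpha),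
   applying eps_w (x) eps_w (x) h to Phi(u) gives back eps_w(u).  Applied to
   Phi(R_x) Phi(R_y) it writes a(x; y; w) as a sum of positive multiples of
   squares of real numbers.

   Total mass 1 comes from the character z, z^* |-> 1, which is 1 on every
   R_(m,n); the involution from the linear anti-automorphism z <-> z^*; and the
   unit axiom from orthogonality. *)
Require Import Defs.
From HB Require Import structures.
From mathcomp Require Import all_boot all_order all_algebra.
From mathcomp Require Import all_classical all_reals all_analysis.
From mathcomp Require Import complex ring.

Set Implicit Arguments.
Unset Strict Implicit.
Unset Printing Implicit Defensive.

Import Order.TTheory GRing.Theory Num.Theory.
Import numFieldNormedType.Exports.

Local Open Scope classical_set_scope.
Local Open Scope ring_scope.
Local Open Scope complex_scope.

(** * Little q-Jacobi polynomials *)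

(** Phi is never built as a map into tensor products. A trilinear form b(v, v', x), with v, v' in Z
    + Z s and x in Z, stands for a functional on the target, and left multiplication by Phi(z) is
    transposed to an operator on such forms. As Z is a quotient of terms, Phi, sigma, the
    anti-automorphism and the coefficient functionals all arise in the same way: as right actions of
    Z given by two operators that satisfy the defining relation. Linear independence of the R_(m,n)
    is not presupposed either; it follows once the recurrences are seen to define such an action on
    families indexed by (m,n).

    In Phi(z) Phi(R_(m,n)) the coefficient of R_(k,l)^(alpha - 1) receives three contributions, each
    a tensor square of a combination of the same two functions: f_(k,l) taken for (m + 1, n) and for
    (m, n - 1). Hence three scalar identities suffice, one of them the cancellation of the mixed
    terms.

    The parameter enters only through T = q^(2(alpha + 1)) = U q^2, and alpha > 0 becomes U = q^(2
    alpha) < 1. *)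

Section JacobiPolynomials.
Context (F : fieldType) (Q : F).

Definition qp (a : F) (k : nat) : F := \prod_(j < k) (1 - a * Q ^+ j).

(** Keeps the denominators away from zero; automatic for T in [0, 1), see [regular_lt1]. *)
Definition regular (T : F) := forall k, 1 - T * Q ^+ k != 0.

(** With degree b and second parameter a - b, the sum alpha + beta + degree + 1 equals alpha + 1 +
    a. So a and b enter symmetrically as the two indices of a disk polynomial, and the recurrences
    move one of them by 1. *)
Definition jacobi_coef (T : F) (a b k : nat) : F :=
  qp (Q ^- b) k * qp (T * Q ^+ a) k / (qp T k * qp Q k) * Q ^+ k.

(* P_b^(alpha, a - b)(.; Q) for T = Q^(alpha + 1). *)
Definition jacobi (T : F) (a b : nat) : {poly F} :=
  \poly_(k < b.+1) jacobi_coef T a b k.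

Lemma qp0 a : qp a 0 = 1.
Proof. by rewrite /qp big_ord0. Qed.

Lemma qpS a k : qp a k.+1 = qp a k * (1 - a * Q ^+ k).
Proof. by rewrite /qp big_ord_recr. Qed.

Lemma qp_shift a k : (1 - a) * qp (a * Q) k = qp a k * (1 - a * Q ^+ k).
Proof.
rewrite -qpS /qp big_ord_recl expr0 mulr1; congr (_ * _).
by apply: eq_bigr => j _; rewrite lift0 exprS mulrA.
Qed.

Lemma qp_neq0 T k : regular T -> qp T k != 0.
Proof. by move=> rT; apply/prodf_neq0 => j _; exact: rT. Qed.

Lemma regularM T k : regular T -> regular (T * Q ^+ k).
Proof. by move=> rT j; rewrite -mulrA -exprD; exact: rT. Qed.

Hypothesis Q0 : Q != 0.
Hypothesis rQ : regular Q.

Lemma subQS_neq0 k : 1 - Q ^+ k.+1 != 0.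
Proof. by rewrite exprS; exact: rQ. Qed.

Lemma subQVS_neq0 k : 1 - Q ^- k.+1 != 0.
Proof.
apply: contraNneq (subQS_neq0 k) => /subr0_eq h.
by rewrite -[Q ^+ _]invrK -h invr1 subrr.
Qed.

Lemma qp_gt b k : (b < k)%N -> qp (Q ^- b) k = 0.
Proof.
move=> bk; apply/eqP/prodf_eq0; exists (Ordinal bk) => //=.
by rewrite mulVf ?subrr // expf_neq0.
Qed.

(** Beyond degree b the factor [qp (Q ^- b) k] vanishes, so coefficients can be compared with no
    case distinction at the top degree. *)
Lemma coef_jacobi T a b k : (jacobi T a b)`_k = jacobi_coef T a b k.
Proof.
rewrite coef_poly ltnS; case: leqP => // bk.
by rewrite /jacobi_coef qp_gt // !mul0r.
Qed.

Lemma jacobi0 T a : jacobi T a 0 = 1.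
Proof.
apply/polyP => -[|k]; rewrite coef_jacobi coef1 /jacobi_coef.
  by rewrite !qp0 expr0 !mulr1 invr1 mulr1.
by rewrite qp_gt // !mul0r.
Qed.

Lemma qp_shiftV b k :
  qp (Q ^- b) k = qp (Q ^- b.+1) k * (1 - Q ^- b.+1 * Q ^+ k) / (1 - Q ^- b.+1).
Proof.
have -> : Q ^- b = Q ^- b.+1 * Q by rewrite exprSr invfM -mulrA mulVf ?mulr1.
by rewrite -qp_shift [RHS]mulrAC mulfV ?mul1r // subQVS_neq0.
Qed.

Lemma qp_shiftT T a k : regular T ->
  qp (T * Q ^+ a.+1) k
  = qp (T * Q ^+ a) k * (1 - T * Q ^+ a * Q ^+ k) / (1 - T * Q ^+ a).
Proof.
by move=> rT; rewrite exprSr mulrA -qp_shift [RHS]mulrAC mulfV ?mul1r.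
Qed.

Lemma qp_shift1 T k : regular T ->
  qp (T * Q) k = qp T k * (1 - T * Q ^+ k) / (1 - T).
Proof.
move=> rT; have := @qp_shiftT T 0 k rT.
by rewrite expr1 expr0 mulr1.
Qed.

(** Moving z or z^* past a polynomial in 1 - z z^* rescales its variable. *)
Definition dilate_poly (c : F) (p : {poly F}) := p \Po (c *: 'X).

Lemma coef_dilate_poly c p k : (dilate_poly c p)`_k = c ^+ k * p`_k.
Proof.
rewrite /dilate_poly; elim/poly_ind: p k => [|p a IH] k.
  by rewrite comp_poly0 !coef0 mulr0.
rewrite comp_polyD comp_polyM comp_polyX comp_polyC -scalerAr !coefD !coefC.
rewrite coefZ !coefMX IH; case: k => [|k] /=.
  by rewrite !mulr0 !add0r expr0 mul1r.
by rewrite !addr0 exprS mulrA.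
Qed.

Lemma subQS1_neq0 k : Q ^+ k.+1 - 1 != 0.
Proof. by rewrite -opprB oppr_eq0 subQS_neq0. Qed.

(** [jacobi_rec1] and [jacobi_rec2] are the polynomial content of the rule for z R_(m,n),
    [jacobi_rec3] and [jacobi_rec4] that for z^* R_(m,n); which one applies depends on the order of
    m and n. *)
Lemma jacobi_rec1 T a b : regular T ->
  jacobi T a b.+1 =
    ((1 - T * Q ^+ a) / (1 - T * Q ^+ (a + b.+1))) *: jacobi T a.+1 b.+1
    + (T * Q ^+ a * (1 - Q ^+ b.+1) / (1 - T * Q ^+ (a + b.+1))) *: jacobi T a b.
Proof.
move=> rT; apply/polyP => k; rewrite coefD !coefZ !coef_jacobi /jacobi_coef.
rewrite qp_shiftT // (qp_shiftV b).
have := subQS1_neq0 b; have := rT a; have := rT (a + b.+1)%N.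
have := qp_neq0 k rT; have := qp_neq0 k rQ; have := expf_neq0 b.+1 Q0.
rewrite exprD; set A := Q ^+ a; set B := Q ^+ b.+1; set K := Q ^+ k.
(* The powers of Q and the q-shifted factorials become free variables, which leaves an identity of
   rational functions. *)
move: A B K (qp _ k) (qp _ k) (qp _ k) (qp _ k) => A B K X Y Z W *.
by field; rewrite ?oner_eq0 /=; do ?[apply/andP; split].
Qed.

Lemma jacobi_rec2 T a b : regular T ->
  dilate_poly Q^-1 (jacobi T a.+1 b) * (1 - 'X) =
    ((1 - T * Q ^+ b) / (1 - T * Q ^+ (a.+1 + b))) *: jacobi T a.+1 b.+1
    + (T * Q ^+ b * (1 - Q ^+ a.+1) / (1 - T * Q ^+ (a.+1 + b))) *: jacobi T a b.
Proof.
move=> rT; apply/polyP => k.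
rewrite mulrBr mulr1 coefB coefMX coefD !coefZ !coef_dilate_poly !coef_jacobi.
rewrite /jacobi_coef qp_shiftT // (qp_shiftV b).
have := subQS1_neq0 b; have := rT a; have := rT (a.+1 + b)%N.
have := expf_neq0 b Q0; have := Q0.
rewrite exprD exprVn; case: k => [|k] /=.
  rewrite !expr0 !qp0 subr0 !exprS; set A := Q ^+ a; set B := Q ^+ b.
  move: A B Q => A B q *.
  by field; rewrite ?oner_eq0 /=; do ?[apply/andP; split].
rewrite qp_shiftT // (qp_shiftV b) !qpS.
have := qp_neq0 k rT; have := qp_neq0 k rQ; have := rQ k; have := rT k.
have := expf_neq0 k Q0.
rewrite !exprVn !exprS; set A := Q ^+ a; set B := Q ^+ b; set K := Q ^+ k.
move: A B K (qp _ k) (qp _ k) (qp _ k) (qp _ k) => A B K X Y Z W *.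
by field; rewrite ?oner_eq0 /=; do ?[apply/andP; split].
Qed.

Lemma jacobi_rec3 T a b : regular T ->
  dilate_poly Q (jacobi T a b.+1) =
    (Q ^+ b.+1 * (1 - T * Q ^+ a) / (1 - T * Q ^+ (a + b.+1)))
      *: jacobi T a.+1 b.+1
    + ((1 - Q ^+ b.+1) / (1 - T * Q ^+ (a + b.+1))) *: jacobi T a b.
Proof.
move=> rT; apply/polyP => k.
rewrite coef_dilate_poly coefD !coefZ !coef_jacobi /jacobi_coef.
rewrite qp_shiftT // (qp_shiftV b).
have := subQS1_neq0 b; have := rT a; have := rT (a + b.+1)%N.
have := qp_neq0 k rT; have := qp_neq0 k rQ; have := expf_neq0 b.+1 Q0.
rewrite exprD; set A := Q ^+ a; set B := Q ^+ b.+1; set K := Q ^+ k.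
move: A B K (qp _ k) (qp _ k) (qp _ k) (qp _ k) => A B K X Y Z W *.
by field; rewrite ?oner_eq0 /=; do ?[apply/andP; split].
Qed.

(** The first factor is z^* z = 1 - Q x moved to the right past z^(a - b). *)
Lemma jacobi_rec4 T a b : regular T -> (b <= a)%N ->
  (1 - Q ^+ (a.+1 - b) *: 'X) * jacobi T a.+1 b =
    (Q ^+ a.+1 * (1 - T * Q ^+ b) / (1 - T * Q ^+ (a.+1 + b)))
      *: jacobi T a.+1 b.+1
    + ((1 - Q ^+ a.+1) / (1 - T * Q ^+ (a.+1 + b))) *: jacobi T a b.
Proof.
move=> rT ba; apply/polyP => k.
rewrite mulrBl mul1r -scalerAl coefB coefZ coefXM coefD !coefZ !coef_jacobi.
rewrite /jacobi_coef qp_shiftT // (qp_shiftV b).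
have := subQS1_neq0 b; have := rT a; have := rT (a.+1 + b)%N.
have := expf_neq0 b Q0; have := Q0.
have -> : Q ^+ (a.+1 - b) = Q ^+ a.+1 / Q ^+ b.
  by rewrite expfB_cond // (negPf Q0) /= add0n leqW.
rewrite exprD; case: k => [|k] /=.
  rewrite !expr0 !qp0 mulr0 subr0 !exprS; set A := Q ^+ a; set B := Q ^+ b.
  move: A B Q => A B q *.
  by field; rewrite ?oner_eq0 /=; do ?[apply/andP; split].
rewrite qp_shiftT // (qp_shiftV b) !qpS.
have := qp_neq0 k rT; have := qp_neq0 k rQ; have := rQ k; have := rT k.
have := expf_neq0 k Q0.
rewrite !exprS; set A := Q ^+ a; set B := Q ^+ b; set K := Q ^+ k.
move: A B K (qp _ k) (qp _ k) (qp _ k) (qp _ k) => A B K X Y Z W *.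
by field; rewrite ?oner_eq0 /=; do ?[apply/andP; split].
Qed.

(** Connection coefficient from alpha to alpha + 1, whose parameter is T Q. Multiplying f_(k,l) by s
    raises the power of s but not the parameter, and this restores the balance. *)
Definition shift_coef T a b :=
  (1 - T * Q ^+ a) * (1 - T * Q ^+ b) / ((1 - T) * (1 - T * Q ^+ (a + b))).

Lemma jacobi_shift T a b : regular T ->
  jacobi T a.+1 b.+1 =
    shift_coef T a.+1 b.+1 *: jacobi (T * Q) a.+1 b.+1
    + (1 - shift_coef T a.+1 b.+1) *: jacobi (T * Q) a b.
Proof.
move=> rT; apply/polyP => k.
rewrite coefD !coefZ !coef_jacobi /jacobi_coef /shift_coef.
rewrite -!mulrA -!exprS !(@qp_shiftT T) // (qp_shiftV b) qp_shift1 //.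
have := subQS1_neq0 b; have := rT a; have := rT (a.+1 + b.+1)%N.
have := rT 0; rewrite expr0 mulr1; have := rT a.+1; have := rT k.
have := qp_neq0 k rT; have := qp_neq0 k rQ; have := expf_neq0 b Q0; have := Q0.
rewrite exprD !exprS; set A := Q ^+ a; set B := Q ^+ b; set K := Q ^+ k.
move: A B K (qp _ k) (qp _ k) (qp _ k) (qp _ k) => A B K X Y Z W *.
by field; rewrite ?oner_eq0 /=; do ?[apply/andP; split].
Qed.

(** The opposite passage: a factor x = s^2 lowers the parameter from alpha + 1 to alpha. *)
Lemma jacobi_mulX T a b : regular T ->
  'X * jacobi (T * Q) a b =
    ((1 - T) * Q ^+ b / (1 - T * Q ^+ (a + b).+1))
      *: (jacobi T a b - jacobi T a.+1 b.+1).
Proof.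
move=> rT; apply/polyP => k.
rewrite coefXM coefZ coefB !coef_jacobi /jacobi_coef.
case: k => [|k] /=.
  by rewrite !qp0 subrr mulr0.
rewrite -!mulrA -!exprS !(@qp_shiftT T) // !(qp_shiftV b) qp_shift1 // !qpS.
have := subQS1_neq0 b; have := rT a; have := rT (a + b).+1.
have := rT 0; rewrite expr0 mulr1; have := rT a.+1; have := rT k; have := rQ k.
have := qp_neq0 k rT; have := qp_neq0 k rQ; have := expf_neq0 b Q0; have := Q0.
rewrite !exprS exprD; set A := Q ^+ a; set B := Q ^+ b; set K := Q ^+ k.
move: A B K (qp _ k) (qp _ k) (qp _ k) (qp _ k) => A B K X Y Z W *.
by field; rewrite ?oner_eq0 /=; do ?[apply/andP; split].
Qed.

End JacobiPolynomials.

(** * q-disk polynomials and their recurrences *)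

Section DiskPolynomials.
Context (R : realType) (q : R).

Local Notation C := R[i].
Local Notation Q := ((q ^+ 2)%:C : C).
Local Notation A := (zalg q).
Local Notation z := (zgen q).
Local Notation zs := (zgen_star q).

(** The variable of the polynomials. It commutes with z and z^* up to a factor Q, and is locked so
    that rules for [z * zs] do not act inside it. *)
Definition zx : A := locked (1 - z * zs).

Lemma zxE : zx = 1 - z * zs.
Proof. by rewrite /zx -lock. Qed.

Definition zev (p : {poly C}) : A := horner_alg zx p.

(* R_(m,n)^(alpha) for T = q^(2(alpha + 1)), see [qdiskE]. *)
Definition zdisk (T : C) (m n : nat) : A :=
  if (n <= m)%N then z ^+ (m - n) * zev (jacobi Q T m n)
  else zev (jacobi Q T n m) * zs ^+ (n - m).

Definition up_coef (T : C) (m n : nat) : C :=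
  (1 - T * Q ^+ m) / (1 - T * Q ^+ (m + n)).

Definition down_coef (T : C) (m n : nat) : C :=
  T * Q ^+ m * (1 - Q ^+ n) / (1 - T * Q ^+ (m + n)).

Definition up_coef_star (T : C) (m n : nat) : C :=
  Q ^+ m * (1 - T * Q ^+ n) / (1 - T * Q ^+ (m + n)).

Definition down_coef_star (T : C) (m n : nat) : C :=
  (1 - Q ^+ m) / (1 - T * Q ^+ (m + n)).

Hypothesis q_gt0 : 0 < q.
Hypothesis q_lt1 : q < 1.

Lemma Q_neq0 : Q != 0.
Proof. by rewrite fmorph_eq0 expf_neq0 // lt0r_neq0. Qed.

Lemma Q_gt0 : 0 < Q.
Proof. by rewrite ltcR exprn_gt0. Qed.

Lemma Q_lt1 : Q < 1.
Proof. by rewrite (_ : 1 = 1%:C) // ltcR exprn_ilt1 // ltW. Qed.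

Lemma regular_lt1 (T : C) : 0 <= T -> T < 1 -> regular Q T.
Proof.
move=> T0 T1 k; rewrite subr_eq0 eq_sym lt_eqF //.
apply: le_lt_trans T1; rewrite ler_piMr // exprn_ile1 //.
  exact: ltW Q_gt0.
exact: ltW Q_lt1.
Qed.

Lemma regular_Q : regular Q Q.
Proof. by apply: regular_lt1 Q_lt1; exact: ltW Q_gt0. Qed.

Lemma zs_z : zs * z = Q *: (z * zs) + (1 - Q) *: 1.
Proof. by rewrite zgen_rel rmorphB rmorph1. Qed.

Lemma z_zs : z * zs = 1 - zx.
Proof. by rewrite zxE opprB addrC subrK. Qed.

Lemma zs_zE : zs * z = 1 - Q *: zx.
Proof.
rewrite zs_z zxE scalerBr scalerBl scale1r opprB addrCA addrA.
by rewrite addrC.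
Qed.

Lemma zx_z : zx * z = Q *: (z * zx).
Proof.
rewrite {1}zxE mulrBl mul1r -mulrA zs_zE mulrBr mulr1 -scalerAr.
by rewrite opprB addrC subrK.
Qed.

Lemma zs_zx : zs * zx = Q *: (zx * zs).
Proof.
rewrite {1}zxE mulrBr mulr1 mulrA zs_zE mulrBl mul1r -scalerAl.
by rewrite opprB addrC subrK.
Qed.

Lemma zevD p r : zev (p + r) = zev p + zev r.
Proof. exact: rmorphD. Qed.

Lemma zevB p r : zev (p - r) = zev p - zev r.
Proof. exact: rmorphB. Qed.

Lemma zevM p r : zev (p * r) = zev p * zev r.
Proof. exact: rmorphM. Qed.

Lemma zevX : zev 'X = zx.
Proof. exact: horner_algX. Qed.

Lemma zevC c : zev c%:P = c *: 1.
Proof. exact: horner_algC. Qed.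

Lemma zevZ c p : zev (c *: p) = c *: zev p.
Proof. by rewrite -mul_polyC zevM zevC mulr_algl. Qed.

Lemma zev1 : zev 1 = 1.
Proof. exact: rmorph1. Qed.

Lemma zev_zX p n : zev p * z ^+ n = z ^+ n * zev (dilate_poly (Q ^+ n) p).
Proof.
elim/poly_ind: p => [|p a IH].
  by rewrite /dilate_poly comp_poly0 /zev rmorph0 mul0r mulr0.
have zxn : zx * z ^+ n = Q ^+ n *: (z ^+ n * zx).
  elim: n {IH} => [|n IH]; first by rewrite !expr0 scale1r mul1r mulr1.
  rewrite exprSr mulrA IH -scalerAl -[_ * zx * z]mulrA zx_z -scalerAr scalerA.
  by rewrite [in RHS]exprSr mulrA.
rewrite /dilate_poly comp_polyD comp_polyM comp_polyX comp_polyC.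
rewrite !(zevD, zevM, zevZ, zevX, zevC) mulrDl mulrDr -mulrA zxn -!scalerAr.
by rewrite (mulrA (zev p)) IH -!scalerAl mul1r mulr1 -mulrA.
Qed.

Lemma zs_zev p : zs * zev p = zev (dilate_poly Q p) * zs.
Proof.
elim/poly_ind: p => [|p a IH].
  by rewrite /dilate_poly comp_poly0 /zev rmorph0 mul0r mulr0.
rewrite /dilate_poly comp_polyD comp_polyM comp_polyX comp_polyC.
rewrite !(zevD, zevM, zevZ, zevX, zevC) mulrDl mulrDr mulrA IH -mulrA zs_zx.
by rewrite -!scalerAr -!scalerAl mul1r mulr1 mulrA.
Qed.

Lemma z_zev p : z * zev p = zev (dilate_poly Q^-1 p) * z.
Proof.
rewrite -[z]expr1 zev_zX expr1; congr (_ * zev _); apply/polyP => k.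
rewrite !coef_dilate_poly mulrA -exprMn mulfV ?expr1n ?mul1r //.
exact: Q_neq0.
Qed.

Lemma zdisk_ge T m n : (n <= m)%N ->
  zdisk T m n = z ^+ (m - n) * zev (jacobi Q T m n).
Proof. by rewrite /zdisk => ->. Qed.

Lemma zdisk_le T m n : (m <= n)%N ->
  zdisk T m n = zev (jacobi Q T n m) * zs ^+ (n - m).
Proof.
rewrite /zdisk; case: ltngtP => // -> _.
by rewrite subnn !expr0 mul1r mulr1.
Qed.

Lemma up_coef0 T m : regular Q T -> up_coef T m 0 = 1.
Proof. by move=> rT; rewrite /up_coef addn0 divff. Qed.

Lemma down_coef0 T m : down_coef T m 0 = 0.
Proof. by rewrite /down_coef expr0 subrr mulr0 mul0r. Qed.

Lemma up_coef_star0 T n : regular Q T -> up_coef_star T 0 n = 1.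
Proof. by move=> rT; rewrite /up_coef_star expr0 mul1r divff. Qed.

Lemma down_coef_star0 T n : down_coef_star T 0 n = 0.
Proof. by rewrite /down_coef_star expr0 subrr mul0r. Qed.

(** At n = 0 the index [n.-1] is fictitious, and [down_coef] vanishes there. *)
Lemma mul_z_zdisk T m n : regular Q T ->
  z * zdisk T m n
  = up_coef T m n *: zdisk T m.+1 n + down_coef T m n *: zdisk T m n.-1.
Proof.
move=> rT; have rQ := regular_Q; case: (leqP n m) => nm.
  rewrite zdisk_ge // (@zdisk_ge _ m.+1) ?leqW // subSn // mulrA -exprS.
  case: n nm => [|n] nm.
    rewrite up_coef0 // down_coef0 scale0r addr0 scale1r.
    by rewrite !jacobi0 //; exact: Q_neq0.
  rewrite zdisk_ge ?(ltnW nm) // jacobi_rec1 //; last exact: Q_neq0.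
  by rewrite zevD !zevZ mulrDr -!scalerAr subnSK.
case: n nm => // n; rewrite ltnS => mn.
rewrite (@zdisk_le _ m n.+1) ?leqW // (@zdisk_le _ m.+1 n.+1) // zdisk_le //=.
(* Moved to the right of the polynomial, z meets a z^*, and z z^* = 1 - x is the extra factor in
   [jacobi_rec2]. *)
rewrite subSS mulrA z_zev -mulrA subSn // (exprS zs) (mulrA z zs) z_zs (mulrA (zev _)).
rewrite -zevX -zev1 -zevB -zevM jacobi_rec2 //; last exact: Q_neq0.
by rewrite zevD !zevZ mulrDl -!(scalerAl _ (zev _)) /up_coef /down_coef (addnC m).
Qed.

Lemma mul_zs_zdisk T m n : regular Q T ->
  zs * zdisk T m n = up_coef_star T m n *: zdisk T m n.+1
                     + down_coef_star T m n *: zdisk T m.-1 n.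
Proof.
move=> rT; have rQ := regular_Q; case: (leqP m n) => mn.
  rewrite zdisk_le // (@zdisk_le _ m n.+1) ?leqW // subSn // mulrA zs_zev.
  rewrite -mulrA -exprS; case: m mn => [|m] mn.
    rewrite up_coef_star0 // down_coef_star0 scale0r addr0 scale1r.
    rewrite !jacobi0 //; try exact: Q_neq0.
    by rewrite /dilate_poly comp_polyC.
  rewrite zdisk_le ?(ltnW mn) // jacobi_rec3 //; last exact: Q_neq0.
  by rewrite zevD !zevZ mulrDl -!(scalerAl _ (zev _)) subnSK // [(n + m.+1)%N]addnC.
case: m mn => // m; rewrite ltnS => nm.
rewrite (@zdisk_ge _ m.+1 n) ?leqW // (@zdisk_ge _ m.+1 n.+1) // zdisk_ge //=.
rewrite subSS subSn // (exprS z) -mulrA (mulrA zs) zs_zE -zevX -zevZ -zev1 -zevB.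
rewrite (mulrA (zev _)) zev_zX -mulrA -zevM; set p := dilate_poly _ _.
have -> : p = 1 - Q ^+ (m.+1 - n) *: 'X.
  rewrite /p /dilate_poly comp_polyB comp_polyZ comp_polyX comp_polyC.
  by rewrite scalerA -exprS subSn.
rewrite jacobi_rec4 //; last exact: Q_neq0.
by rewrite zevD !zevZ mulrDr -!scalerAr.
Qed.

(** At n = 0 the connection coefficient is 1, so the term with [n.-1] disappears. *)
Lemma zdisk_shift T m n : regular Q T ->
  zdisk T m.+1 n = shift_coef Q T m.+1 n *: zdisk (T * Q) m.+1 n
                   + (1 - shift_coef Q T m.+1 n) *: zdisk (T * Q) m n.-1.
Proof.
move=> rT; have rQ := regular_Q; case: n => [|n].
  have -> : shift_coef Q T m.+1 0 = 1.
    rewrite /shift_coef addn0 expr0 mulr1 [X in X / _]mulrC divff //.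
    by rewrite mulf_neq0 //; have := rT 0; rewrite expr0 mulr1.
  by rewrite subrr scale0r addr0 scale1r !zdisk_ge // !jacobi0 //; exact: Q_neq0.
case: (leqP n m) => nm.
  rewrite !zdisk_ge //= jacobi_shift //; last exact: Q_neq0.
  by rewrite zevD !zevZ mulrDr -!scalerAr subSS.
have mn := ltnW nm.
rewrite !zdisk_le //= jacobi_shift //; last exact: Q_neq0.
rewrite zevD !zevZ mulrDl -!(scalerAl _ (zev _)) subSS.
by rewrite /shift_coef addnC (mulrC (1 - T * Q ^+ m.+1)).
Qed.

Lemma zdisk_shift0 T n : zdisk T 0 n = zdisk (T * Q) 0 n.
Proof. by rewrite !zdisk_le // !jacobi0 //; exact: Q_neq0. Qed.

Lemma zx_zdisk T m n : regular Q T ->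
  zx * zdisk (T * Q) m n =
    ((1 - T) * Q ^+ m / (1 - T * Q ^+ (m + n).+1))
      *: (zdisk T m n - zdisk T m.+1 n.+1).
Proof.
move=> rT; have rQ := regular_Q; case: (leqP n m) => nm.
  rewrite !zdisk_ge // subSS -mulrBr -zevB -{1}zevX mulrA zev_zX -mulrA -zevM.
  rewrite /dilate_poly comp_polyX -scalerAl jacobi_mulX //; last exact: Q_neq0.
  rewrite !zevZ scalerA -scalerAr; congr (_ *: _).
  rewrite mulrA mulrCA; congr (_ * _ / _).
  by rewrite -exprD subnK.
have mn := ltnW nm.
rewrite !zdisk_le // subSS -mulrBl -zevB -{1}zevX mulrA -zevM.
rewrite jacobi_mulX //; last exact: Q_neq0.
by rewrite zevZ -(scalerAl _ (zev _)) (addnC m).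
Qed.

End DiskPolynomials.

(** * Modules over the algebra Z *)

Section RightModules.
Context (R : realType) (q : R).
Local Notation C := R[i].
Local Notation Q := ((q ^+ 2)%:C : C).
Local Notation A := (zalg q).

Section Action.
Context (E : lmodType C) (f g : E -> E) (P : E -> Prop).

Definition linear_endo (h : E -> E) :=
  forall a u v, h (a *: u + v) = a *: h u + h v.

(* The generators act on all of [E], but satisfy the defining relation only on
   the vectors in [P]. *)
Record right_zmodule : Prop := RightZmodule {
  rzm_f_linear : linear_endo f;
  rzm_g_linear : linear_endo g;
  rzm_closed : forall a u v, P u -> P v -> P (a *: u + v);
  rzm_f_closed : forall v, P v -> P (f v);
  rzm_g_closed : forall v, P v -> P (g v);
  rzm_rel : forall v, P v -> f (g v) = Q *: g (f v) + (1 - Q) *: v }.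

(** The left factor of a product acts first, which makes this a right action: exactly what
    precomposing functionals with left multiplication gives. *)
Fixpoint zterm_act (t : zterm R) (v : E) : E :=
  match t with
  | ZConst a => a *: v
  | ZGen => f v
  | ZGenStar => g v
  | ZAdd t u => zterm_act t v + zterm_act u v
  | ZMul t u => zterm_act u (zterm_act t v)
  end.

(** The choice of representative is harmless only on vectors in [P], see [zactE]. *)
Definition zact (x : A) : E -> E := zterm_act (repr x).

Hypothesis H : right_zmodule.

Lemma zterm_act_linear t : linear_endo (zterm_act t).
Proof.
elim: t => [c|||t IHt u IHu|t IHt u IHu] a v w /=.
- by rewrite scalerDr !scalerA mulrC.
- exact: rzm_f_linear.
- exact: rzm_g_linear.
- by rewrite IHt IHu scalerDr addrACA.
- by rewrite IHt IHu.
Qed.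

Lemma zterm_act_closed t v : P v -> P (zterm_act t v).
Proof.
have P0 w : P w -> P 0.
  by move=> Pw; have := rzm_closed H (-1) Pw Pw; rewrite scaleN1r addNr.
elim: t v => [c|||t IHt u IHu|t IHt u IHu] v Pv /=.
- by rewrite -[_ *: _]addr0; apply: (rzm_closed H) => //; exact: P0 Pv.
- exact: rzm_f_closed.
- exact: rzm_g_closed.
- rewrite -[zterm_act t v]scale1r.
  by apply: (rzm_closed H); [exact: IHt|exact: IHu].
- exact/IHu/IHt.
Qed.

Lemma zterm_act0 t : zterm_act t 0 = 0.
Proof.
have := zterm_act_linear t (-1) 0 0.
by rewrite !scaleN1r oppr0 addr0 addNr.
Qed.

Lemma zterm_actD t v w : zterm_act t (v + w) = zterm_act t v + zterm_act t w.
Proof. by rewrite -[v]scale1r zterm_act_linear !scale1r. Qed.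

Lemma zterm_actZ t a v : zterm_act t (a *: v) = a *: zterm_act t v.
Proof. by rewrite -[a *: v]addr0 zterm_act_linear zterm_act0 addr0. Qed.

Lemma zterm_act_cong t u : zcong q t u ->
  forall v, P v -> zterm_act t v = zterm_act u v.
Proof.
elim=> //=.
- by move=> t1 u1 _ IH v Pv; rewrite IH.
- by move=> t1 u1 w1 _ IH1 _ IH2 v Pv; rewrite IH1 // IH2.
- by move=> t1 t2 u1 u2 _ IH1 _ IH2 v Pv; rewrite IH1 // IH2.
- move=> t1 t2 u1 u2 _ IH1 _ IH2 v Pv.
  by rewrite IH1 // IH2 //; exact: zterm_act_closed.
- by move=> *; rewrite addrA.
- by move=> *; rewrite addrC.
- by move=> *; rewrite scale0r add0r.
- by move=> *; rewrite scale1r.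
- by move=> *; rewrite !scale0r zterm_act0.
- by move=> *; rewrite zterm_actD.
- by move=> *; rewrite scalerDl.
- by move=> *; rewrite scalerA mulrC.
- by move=> *; rewrite zterm_actZ.
- move=> v Pv; rewrite (rzm_rel H) // (rmorphB (real_complex R)) rmorph1.
  by have /= -> := zterm_actZ (ZMul (ZGen R) (ZGenStar R)) Q v.
Qed.

Lemma zactE t v : P v -> zact (zclass q t) v = zterm_act t v.
Proof. exact: zterm_act_cong (repr_zclass _ _) _. Qed.

Lemma zactZr x a v : zact x (a *: v) = a *: zact x v.
Proof. exact: zterm_actZ. Qed.

Lemma zact_closed x v : P v -> P (zact x v).
Proof. exact: zterm_act_closed. Qed.

Lemma zact1 v : P v -> zact 1 v = v.
Proof. by move=> Pv; rewrite zactE //= scale1r. Qed.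

Lemma zact_gen v : P v -> zact (zgen q) v = f v.
Proof. by move=> Pv; rewrite zactE. Qed.

Lemma zact_gen_star v : P v -> zact (zgen_star q) v = g v.
Proof. by move=> Pv; rewrite zactE. Qed.

Lemma zactD x y v : P v -> zact (x + y) v = zact x v + zact y v.
Proof. by move=> Pv; rewrite [x + y]/(zadd x y) /zadd zactE. Qed.

Lemma zactM x y v : P v -> zact (x * y) v = zact y (zact x v).
Proof. by move=> Pv; rewrite [x * y]/(zmul x y) /zmul zactE. Qed.

Lemma zactZ a x v : P v -> zact (a *: x) v = a *: zact x v.
Proof.
move=> Pv; rewrite [a *: x]/(zmul (zclass q (ZConst a)) x) zactM //.
by rewrite zactE //= zactZr.
Qed.

Lemma zact0 v : P v -> zact 0 v = 0.
Proof. by move=> Pv; rewrite -(scale0r 1) zactZ // scale0r. Qed.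

Lemma zactB x y v : P v -> zact (x - y) v = zact x v - zact y v.
Proof. by move=> Pv; rewrite -scaleN1r zactD // zactZ // scaleN1r. Qed.

Lemma zact_sum I (r : seq I) (S : pred I) (x : I -> A) v : P v ->
  zact (\sum_(i <- r | S i) x i) v = \sum_(i <- r | S i) zact (x i) v.
Proof.
by move=> Pv; apply: (big_morph (zact^~ v)) => [y w|]; rewrite ?zactD ?zact0.
Qed.

End Action.

(* Unlike the involution of Z, [zdag] is linear; both exchange R_(m,n) and
   R_(n,m). *)
Definition zdag_gen (v : A) : A := zgen_star q * v.
Definition zdag_gen_star (v : A) : A := zgen q * v.
Definition zdag (x : A) : A := zact zdag_gen zdag_gen_star x 1.

(** Exchanging z and z^* while reversing products fixes both z z^* and z^* z, hence the defining
    relation. *)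
Lemma zdag_module : right_zmodule zdag_gen zdag_gen_star (fun=> True).
Proof.
split=> // [a u v|a u v|v _]; rewrite /zdag_gen /zdag_gen_star.
- by rewrite mulrDr scalerAr.
- by rewrite mulrDr scalerAr.
- by rewrite !mulrA zs_z mulrDl -!scalerAl mul1r.
Qed.

Lemma zdagE x v : zact zdag_gen zdag_gen_star x v = zdag x * v.
Proof.
rewrite /zdag /zact; elim: (repr x) v => [c|||t IHt u IHu|t IHt u IHu] v /=.
- by rewrite -scalerAl mul1r.
- by rewrite /zdag_gen mulr1.
- by rewrite /zdag_gen_star mulr1.
- by rewrite IHt IHu -mulrDl.
- by rewrite IHt IHu (IHu (zterm_act _ _ _ _)) mulrA.
Qed.

Lemma zdag1 : zdag 1 = 1.
Proof. exact: (zact1 zdag_module). Qed.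

Lemma zdagD x y : zdag (x + y) = zdag x + zdag y.
Proof. exact: (zactD zdag_module). Qed.

Lemma zdagB x y : zdag (x - y) = zdag x - zdag y.
Proof. exact: (zactB zdag_module). Qed.

Lemma zdagZ a x : zdag (a *: x) = a *: zdag x.
Proof. exact: (zactZ zdag_module). Qed.

Lemma zdag0 : zdag 0 = 0.
Proof. exact: (zact0 zdag_module). Qed.

Lemma zdagM x y : zdag (x * y) = zdag y * zdag x.
Proof. by rewrite {1}/zdag (zactM zdag_module) // zdagE. Qed.

Lemma zdag_z : zdag (zgen q) = zgen_star q.
Proof. by rewrite /zdag (zact_gen zdag_module) // /zdag_gen mulr1. Qed.

Lemma zdag_zs : zdag (zgen_star q) = zgen q.
Proof. by rewrite /zdag (zact_gen_star zdag_module) // /zdag_gen_star mulr1. Qed.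

Lemma zdagX x n : zdag (x ^+ n) = zdag x ^+ n.
Proof.
elim: n => [|n IH]; first by rewrite !expr0 zdag1.
by rewrite exprS zdagM IH -exprSr.
Qed.

Lemma zdag_zev p : zdag (zev q p) = zev q p.
Proof.
have zdx : zdag (zx q) = zx q.
  by rewrite zxE zdagB zdag1 zdagM zdag_z zdag_zs.
elim/poly_ind: p => [|p a IH]; first by rewrite /zev rmorph0 zdag0.
rewrite !(zevD, zevM, zevX, zevC) zdagD zdagM zdagZ zdag1 zdx IH.
by rewrite -!zevX -!zevM mulrC.
Qed.

Lemma zdag_zdisk T m n : zdag (zdisk q T m n) = zdisk q T n m.
Proof.
case: (leqP n m) => [nm|/ltnW nm].
  by rewrite zdisk_ge // (@zdisk_le _ _ T n) // zdagM zdagX zdag_z zdag_zev.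
by rewrite zdisk_le // (@zdisk_ge _ _ T n) // zdagM zdagX zdag_zs zdag_zev.
Qed.

Hypothesis q_gt0 : 0 < q.
Hypothesis q_lt1 : q < 1.

(** The anti-automorphism turns the rule for left multiplication by z^* into this one, which is why
    the indices of the coefficients are swapped. *)
Lemma zdisk_mul_z T m n : regular Q T ->
  zdisk q T m n * zgen q = up_coef_star q T n m *: zdisk q T m.+1 n
                           + down_coef_star q T n m *: zdisk q T m n.-1.
Proof.
move=> rT; rewrite -!(zdag_zdisk T n) -(zdag_zdisk T n.-1) -zdag_zs -zdagM.
by rewrite mul_zs_zdisk // zdagD !zdagZ.
Qed.

Lemma zdisk_mul_zs T m n : regular Q T ->
  zdisk q T m n * zgen_star q = up_coef q T n m *: zdisk q T m n.+1
                                + down_coef q T n m *: zdisk q T m.-1 n.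
Proof.
move=> rT; rewrite -!(zdag_zdisk T n) -(zdag_zdisk T n.+1) -zdag_z -zdagM.
by rewrite mul_z_zdisk // zdagD !zdagZ.
Qed.

End RightModules.

(** * Coefficient functionals *)

Section Coefficients.
Context (R : realType) (q : R).
Local Notation C := R[i].
Local Notation Q := ((q ^+ 2)%:C : C).
Local Notation A := (zalg q).
Local Notation dual := (nat * nat -> C^o).

Section Functional.
Context (T : C).

(* The transposes of left multiplication by the generators in the basis
   [zdisk q T m n]. *)
Definition coef_gen (g : dual) : dual := fun x =>
  up_coef q T x.1 x.2 * g (x.1.+1, x.2)
  + down_coef q T x.1 x.2 * g (x.1, x.2.-1).

Definition coef_gen_star (g : dual) : dual := fun x =>
  up_coef_star q T x.1 x.2 * g (x.1, x.2.+1)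
  + down_coef_star q T x.1 x.2 * g (x.1.-1, x.2).

Definition dual_basis (x : nat * nat) : dual := fun y => (y == x)%:R.

(** The functional eps_w composed with left multiplication by u, evaluated at R_(0,0) = 1. *)
Definition zcoef (w : nat * nat) (u : A) : C :=
  zact coef_gen coef_gen_star u (dual_basis w) (0%N, 0%N).

Hypothesis q_gt0 : 0 < q.
Hypothesis q_lt1 : q < 1.
Hypothesis rT : regular Q T.

Lemma up_coef_neq0 m n : up_coef q T m n != 0.
Proof. by rewrite mulf_neq0 // invr_eq0. Qed.

Lemma up_coef_star_neq0 m n : up_coef_star q T m n != 0.
Proof. by rewrite !mulf_neq0 ?invr_eq0 // expf_neq0 // Q_neq0. Qed.

(** The source of linear independence: the recurrence coefficients are compatible with the defining
    relation, so the functionals dual to the R_(m,n) exist. *)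
Lemma coef_module : right_zmodule q coef_gen coef_gen_star (fun=> True).
Proof.
split=> // [a u v|a u v|v _]; apply/funext => -[m n];
  rewrite /coef_gen /coef_gen_star !fctE /=.
- rewrite -![_ *: _ : C^o]/(_ * _).
  by ring.
- rewrite -![_ *: _ : C^o]/(_ * _).
  by ring.
rewrite -![_ *: _ : C^o]/(_ * _).
rewrite /up_coef /down_coef /up_coef_star /down_coef_star.
move: rT; move: (q ^+ 2)%:C => p h.
have := (h (m + n), h (m + n).+1, h (m + n).+2)%N.
(* On the edges [.-1] stays at 0, so the identity takes a different form there. *)
case: m => [|m]; case: n => [|n] /=.
- rewrite !(addSn, addnS, addn0, add0n, exprS, expr0, mul1r, mulr1).
  move=> [[h0 h1] h2].
  by field; do ?[apply/andP; split].
- have := h n; rewrite !(addSn, addnS, addn0, add0n, exprS, expr0, mul1r, mulr1).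
  move: (_ ^+ n) => b h3 [[h0 h1] h2].
  by field; do ?[apply/andP; split].
- have := h m; rewrite !(addSn, addnS, addn0, add0n, exprS, expr0, mul1r, mulr1).
  move: (_ ^+ m) => a h3 [[h0 h1] h2].
  by field; do ?[apply/andP; split].
- have := h (m + n)%N; have := h (m + n).+1.
  rewrite !(addSn, addnS, exprS, exprD).
  move: (_ ^+ m) (_ ^+ n) => a b h3 h4 [[h0 h1] h2].
  field; rewrite h0 /= (_ : a * (p * b) = p * (a * b)) ?h3 /=; last by ring.
  by rewrite (_ : p * a * (p * (p * b)) = p * (p * a * (p * b))) //; ring.
Qed.

Lemma zdisk00 : zdisk q T 0 0 = 1.
Proof.
by rewrite zdisk_le // jacobi0 ?zev1 ?mulr1 //; exact: Q_neq0.
Qed.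

Lemma zact_zdisk m n g : zact coef_gen coef_gen_star (zdisk q T m n) g (0%N, 0%N)
  = g (m, n).
Proof.
elim: m n g => [|m IH] n g.
  elim: n g => [|n IH] g.
    by rewrite zdisk00 (zact1 coef_module).
  have -> : zdisk q T 0 n.+1 = zgen_star q * zdisk q T 0 n.
    by rewrite mul_zs_zdisk // up_coef_star0 // down_coef_star0 scale0r addr0 scale1r.
  rewrite (zactM coef_module) // (zact_gen_star coef_module) // IH.
  by rewrite /coef_gen_star /= up_coef_star0 // down_coef_star0 mul0r addr0 mul1r.
apply: (mulfI (up_coef_neq0 m n)).
have -> : up_coef q T m n * zact coef_gen coef_gen_star (zdisk q T m.+1 n) g (0%N, 0%N)
   = zact coef_gen coef_gen_star (up_coef q T m n *: zdisk q T m.+1 n) g (0%N, 0%N).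
  by rewrite (zactZ coef_module) // fctE.
have -> : up_coef q T m n *: zdisk q T m.+1 n
    = zgen q * zdisk q T m n - down_coef q T m n *: zdisk q T m n.-1.
  by rewrite mul_z_zdisk // addrK.
rewrite (zactB coef_module) // (zactM coef_module) // (zactZ coef_module) //.
rewrite (zact_gen coef_module) // !fctE /= !IH.
by rewrite -![_ *: _ : C^o]/(_ * _) /coef_gen /= addrK.
Qed.

Lemma zcoef_zdisk w m n : zcoef w (zdisk q T m n) = ((m, n) == w)%:R.
Proof. exact: zact_zdisk. Qed.

Lemma zcoefD w u v : zcoef w (u + v) = zcoef w u + zcoef w v.
Proof. by rewrite /zcoef (zactD coef_module). Qed.

Lemma zcoefZ w a u : zcoef w (a *: u) = a * zcoef w u.
Proof. by rewrite /zcoef (zactZ coef_module). Qed.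

Lemma zcoef0 w : zcoef w 0 = 0.
Proof. by rewrite -(scale0r 0) zcoefZ mul0r. Qed.

Lemma zcoef_sum w I (r : seq I) (S : pred I) (x : I -> A) :
  zcoef w (\sum_(i <- r | S i) x i) = \sum_(i <- r | S i) zcoef w (x i).
Proof. by apply: (big_morph (zcoef w)) => [u v|]; rewrite ?zcoefD ?zcoef0. Qed.

Definition zspan (u : A) := exists s : seq (C * (nat * nat)),
  u = \sum_(p <- s) p.1 *: zdisk q T p.2.1 p.2.2.

Lemma zspanD u v : zspan u -> zspan v -> zspan (u + v).
Proof. by move=> [s ->] [t ->]; exists (s ++ t); rewrite big_cat. Qed.

Lemma zspanZ a u : zspan u -> zspan (a *: u).
Proof.
move=> [s ->]; exists [seq (a * p.1, p.2) | p <- s]; rewrite big_map scaler_sumr.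
by apply: eq_bigr => p _; rewrite scalerA.
Qed.

Lemma zspan_zdisk m n : zspan (zdisk q T m n).
Proof. by exists [:: (1, (m, n))]; rewrite big_seq1 scale1r. Qed.

Lemma zspan_sum I (r : seq I) (x : I -> A) :
  (forall i, zspan (x i)) -> zspan (\sum_(i <- r) x i).
Proof.
move=> h; apply: big_ind => //; last exact: zspanD.
by exists [::]; rewrite big_nil.
Qed.

Lemma zspan_all u : zspan u.
Proof.
rewrite -[u]mulr1; have : zspan 1 by rewrite -zdisk00; exact: zspan_zdisk.
(* With 1 replaced by any v in the span, the claim says that the span is a left ideal and passes
   through products of terms. *)
elim/zalg_ind: u; move: (1 : A) => v t.
elim: t v => [c|||t IHt u IHu|t IHt u IHu] v hv.
- rewrite (_ : _ * v = c *: v) //; exact: zspanZ.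
- have [s ->] := hv; rewrite mulr_sumr; apply: zspan_sum => p.
  rewrite -scalerAr mul_z_zdisk //; apply/zspanZ/zspanD;
    by apply/zspanZ/zspan_zdisk.
- have [s ->] := hv; rewrite mulr_sumr; apply: zspan_sum => p.
  rewrite -scalerAr mul_zs_zdisk //; apply/zspanZ/zspanD;
    by apply/zspanZ/zspan_zdisk.
- have -> : zclass q (ZAdd t u) = zclass q t + zclass q u by rewrite -zclassD.
  by rewrite mulrDl; apply: zspanD; [exact: IHt|exact: IHu].
- have -> : zclass q (ZMul t u) = zclass q t * zclass q u by rewrite -zclassM.
  by rewrite -mulrA; apply/IHt/IHu.
Qed.

Lemma zdisk_expansion u : exists2 s : seq (nat * nat), uniq s &
  (forall w, w \notin s -> zcoef w u = 0) /\
  u = \sum_(w <- s) zcoef w u *: zdisk q T w.1 w.2.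
Proof.
have [s us] := zspan_all u; exists (undup [seq p.2 | p <- s]).
  exact: undup_uniq.
have cE w : zcoef w u = \sum_(p <- s) p.1 * (p.2 == w)%:R.
  rewrite us zcoef_sum; apply: eq_bigr => -[a [m n]] _.
  by rewrite zcoefZ zcoef_zdisk.
split=> [w|].
  rewrite mem_undup => ws; rewrite cE big1_seq // => p /andP[_ ps].
  case: eqP => [pw|]; last by rewrite mulr0.
  by move: ws; rewrite -pw map_f.
rewrite {1}us (eq_bigr _ (fun w _ => congr1 (fun c => c *: _) (cE w))).
under [RHS]eq_bigr do rewrite scaler_suml.
rewrite exchange_big /= big_seq [RHS]big_seq; apply: eq_bigr => p ps.
rewrite (bigD1_seq p.2) ?undup_uniq //=; last by rewrite mem_undup map_f.
rewrite eqxx mulr1 big1 ?addr0 // => w /negPf wp.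
by rewrite eq_sym wp mulr0 scale0r.
Qed.

Lemma zcoef_zdag x u : zcoef (x.2, x.1) (zdag u) = zcoef x u.
Proof.
have [s us] := zspan_all u; rewrite {}us.
rewrite zcoef_sum (big_morph (@zdag _ q) (@zdagD _ q) (@zdag0 _ q)) zcoef_sum.
apply: eq_bigr => -[a [m n]] _; rewrite zdagZ !zcoefZ zdag_zdisk !zcoef_zdisk.
by case: x => i j; rewrite !xpair_eqE andbC.
Qed.

End Functional.
End Coefficients.

(** * Coefficients of the addition formula *)

Section AdditionCoefficients.
Context (F : fieldType) (Q c U : F).
Local Notation w := (qp Q Q).
Local Notation u := (qp Q U).

(** The c_(k,l) of the addition formula for R_(M+k,N+l), with c = q, Q = q^2 and U = q^(2 alpha).
    Taking M = m - k and N = n - l as arguments avoids truncated subtraction. *)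
Definition addition_coef (M k N l : nat) : F :=
  c ^+ (k + l) / Q ^+ (M * (k + l)) * (w (M + k) * w (N + l))
  / (w k * w M * w l * w N) * (1 - U)
  * (u (N + (k + l)).+1 * u (M + (k + l)).+1 * u k * u l)
  / (u (N + l).+1 * u (M + k).+1 * u (k + l) * u (k + l).+1).

Hypothesis Q_neq0 : Q != 0.
Hypothesis c_neq0 : c != 0.
Hypothesis rQ : regular Q Q.
Hypothesis rU : regular Q U.

Let w0 k : w k != 0. Proof. exact: qp_neq0. Qed.
Let u0 k : u k != 0. Proof. exact: qp_neq0. Qed.
Let QS k : 1 - Q ^+ k.+1 != 0. Proof. exact: subQS_neq0. Qed.
Let Q0 k : Q ^+ k != 0. Proof. by rewrite !expf_neq0. Qed.
Let wS k : w k.+1 = w k * (1 - Q ^+ k.+1).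
Proof. by rewrite qpS -exprS. Qed.

(** This and the next three ratios compare c_(k,l) for (m, n) with c_(k,l) for (m + 1, n) and (m, n
    - 1), and with its neighbours c_(k-1,l) and c_(k,l+1). *)
Lemma addition_coef_SM M k N l :
  addition_coef M.+1 k N l = addition_coef M k N l / Q ^+ (k + l)
    * ((1 - Q ^+ (M + k).+1) * (1 - U * Q ^+ (M + (k + l)).+1))
    / ((1 - Q ^+ M.+1) * (1 - U * Q ^+ (M + k).+1)).
Proof.
rewrite /addition_coef mulSn (exprD Q (k + l)) !addSn !wS !(qpS _ _ (_.+1)).
have := (w0 k, w0 l, w0 N, w0 M, u0 (N + l).+1, u0 (M + k).+1, u0 (k + l)).
have := (u0 (k + l).+1, QS M, rU (M + k).+1, Q0 (k + l), Q0 (M * (k + l))).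
move: (Q ^+ (k + l)) (Q ^+ (M * (k + l))) (c ^+ (k + l)) => Qj QMj cj.
move: (w k) (w l) (w N) (w M) => w1 w2 w3 w4.
move: (u _) (u _) (u _) (u _) (u k) (u l) => u1 u2 u3 u4 u5 u6.
move=> [] [] [] [] ? ? ? ? ? [] [] [] [] [] [] ? ? ? ? ? ? ?.
by field; do ?[apply/andP; split].
Qed.

Lemma addition_coef_PN M k N l :
  addition_coef M k N l = addition_coef M k N.+1 l
    * ((1 - Q ^+ N.+1) * (1 - U * Q ^+ (N + l).+1))
    / ((1 - Q ^+ (N + l).+1) * (1 - U * Q ^+ (N + (k + l)).+1)).
Proof.
rewrite /addition_coef !addSn !wS !(qpS _ _ (_.+1)).
have := (w0 k, w0 l, w0 N, w0 M, u0 (N + l).+1, u0 (M + k).+1, u0 (k + l)).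
have := (u0 (k + l).+1, QS N, QS (N + l), rU (N + (k + l)).+1, rU (N + l).+1).
have := (Q0 (M * (k + l))).
move: (Q ^+ (M * (k + l))) (c ^+ (k + l)) => QMj cj.
move: (w k) (w l) (w N) (w M) => w1 w2 w3 w4.
move: (u _) (u _) (u _) (u _) (u k) (u l) => u1 u2 u3 u4 u5 u6.
move=> ? [] [] [] [] ? ? ? ? ? [] [] [] [] [] [] ? ? ? ? ? ? ?.
by field; do ?[apply/andP; split].
Qed.

Lemma addition_coef_Pk M k N l :
  addition_coef M.+1 k N l = addition_coef M k.+1 N l
    * (Q ^+ M * ((1 - Q ^+ k.+1) * (1 - U * Q ^+ (k + l))
                 * (1 - U * Q ^+ (k + l).+1)))
    / (c * Q ^+ (k + l) * ((1 - Q ^+ M.+1) * (1 - U * Q ^+ k)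
       * (1 - U * Q ^+ (N + (k + l)).+1))).
Proof.
rewrite /addition_coef mulSn !(addSn, addnS) mulnS !(exprD Q) exprS.
rewrite !wS !(qpS _ _ (_.+1)) !(qpS _ _ (k + l)) !(qpS _ _ k).
have := (w0 k, w0 l, w0 N, w0 M, u0 (N + l).+1, u0 (M + k).+1, u0 (k + l)).
have := (u0 (M + k).+2, QS M, QS k, rU (N + (k + l)).+1, rU k, Q0 M).
have := (rU (k + l), rU (k + l).+1, rU (M + k).+1, Q0 (k + l), Q0 (M * (k + l))).
rewrite !(qpS _ _ (_.+1)) !(exprS Q (_ + _)) !(exprD Q).
move: (Q ^+ (M * (k + l))) (c ^+ (k + l)) => QMj cj.
move: (w k) (w l) (w N) (w M) (w (N + l)) => w1 w2 w3 w4 w5.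
move: (u _) (u _) (u _) (u _) (u k) (u l) => u1 u2 u3 u4 u5 u6.
move=> [] [] [] [] ? ? ? ? ? [] [] [] [] [] ? ? ? ? ? ?.
move=> [] [] [] [] [] [] ? ? ? ? ? ? ?.
by field; do ?[apply/andP; split].
Qed.

Lemma addition_coef_Sl M k N l :
  addition_coef M k N l.+1 = addition_coef M k N.+1 l
    * (c * ((1 - Q ^+ N.+1) * (1 - U * Q ^+ (M + (k + l)).+1)
            * (1 - U * Q ^+ l)))
    / (Q ^+ M * ((1 - Q ^+ l.+1) * (1 - U * Q ^+ (k + l))
                 * (1 - U * Q ^+ (k + l).+1))).
Proof.
rewrite /addition_coef !(addSn, addnS) mulnS !(exprD Q) exprS.
rewrite !wS !(qpS _ _ (_.+1)) !(qpS _ _ (k + l)) !(qpS _ _ l).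
have := (w0 k, w0 l, w0 N, w0 M, u0 (N + l).+1, u0 (M + k).+1, u0 (k + l)).
have := (u0 (N + l).+2, QS N, QS l, rU (M + (k + l)).+1, rU l, Q0 M).
have := (rU (k + l), rU (k + l).+1, rU (N + l).+1, Q0 (k + l), Q0 (M * (k + l))).
rewrite !(qpS _ _ (_.+1)) !(exprS Q (_ + _)) !(exprD Q).
move: (Q ^+ (M * (k + l))) (c ^+ (k + l)) => QMj cj.
move: (w k) (w l) (w N) (w M) (w (M + k)) => w1 w2 w3 w4 w5.
move: (u _) (u _) (u _) (u _) (u k) (u l) => u1 u2 u3 u4 u5 u6.
move=> [] [] [] [] ? ? ? ? ? [] [] [] [] [] ? ? ? ? ? ?.
move=> [] [] [] [] [] [] ? ? ? ? ? ? ?.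
by field; do ?[apply/andP; split].
Qed.

Lemma addition_coef0 M N : addition_coef M 0 N 0 = 1.
Proof.
rewrite /addition_coef !addn0 muln0 !expr0 !qp0 (qpS _ _ 0) qp0 expr0.
have := (w0 M, w0 N, u0 N.+1, u0 M.+1, rU 0); rewrite expr0.
move: (w M) (w N) (u _) (u _) => w1 w2 u1 u2 [] [] [] [] ? ? ? ?.
rewrite mulr1 => ?.
by field; rewrite oner_eq0 /=; do ?[apply/andP; split].
Qed.

End AdditionCoefficients.

(* The three scalar identities behind the induction step of the addition
   formula, with Q^M, Q^N, Q^k, Q^l abstracted to a, b, k, l. *)
Section AdditionIdentities.
Context (F : fieldType) (p U a b k l : F).
Hypotheses (p0 : p != 0) (a0 : a != 0) (k0 : k != 0) (l0 : l != 0).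
Hypotheses (pa : 1 - p * a != 0) (Ukl : 1 - U * (k * l) != 0).
Hypotheses (Upkl : 1 - U * (p * (k * l)) != 0).
Hypotheses (Ubkl : 1 - U * (b * (k * l)) != 0).
Hypotheses (Upabkl : 1 - U * (p * (a * b * (k * l))) != 0).

(** tau is the parameter of f_(k,l). The factors up and down come from z f_(k,l), shift from s
    f_(k-1,l) and conn from s f_(k,l+1); y and z are the scalar weights of the last two
    contributions, divided by c_(k,l). *)
Let tau := U * (p * (k * l)).
Let up := (1 - tau * a) / (1 - tau * (a * b)).
Let down := tau * a * (1 - b) / (1 - tau * (a * b)).
Let shift := (1 - tau * a) * (1 - U * (b * (k * l)))
             / ((1 - U * (k * l)) * (1 - tau * (a * b))).
Let conn := (1 - tau) * a / (1 - tau * (a * b)).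
Let y := p * a * (1 - k) * (1 - U * (k * l))
         / (k * l * (1 - p * a) * (1 - U * (b * (k * l)))).
Let z := p * U * k * (1 - b) * (1 - U * (p * (a * (k * l)))) * (1 - U * l)
         / (a * (1 - U * (k * l)) * (1 - U * (p * (k * l))) ^+ 2).

(** Coefficient of G (x) G, where G is f_(k,l) for (m + 1, n). The next identity is the coefficient
    of H (x) H, with H for (m, n - 1). *)
Lemma addition_identity_up :
  up ^+ 2 / (k * l) + y * shift ^+ 2 + z * conn ^+ 2 =
  (1 - p * (a * k)) * (1 - U * (p * (a * (k * l))))
  / (k * l * (1 - p * a) * (1 - U * (p * (a * b * (k * l))))).
Proof.
rewrite /up /shift /conn /y /z /tau.
have h : 1 - U * (p * (k * l)) * (a * b) != 0.
  by rewrite (_ : U * _ * _ = U * (p * (a * b * (k * l)))) //; ring.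
by field; do ?[apply/andP; split].
Qed.

Lemma addition_identity_down :
  down ^+ 2 / (k * l) + y * (1 - shift) ^+ 2 + z * conn ^+ 2 =
  U * (p * (a * k)) * (1 - b) * (1 - U * (b * l))
  / ((1 - U * (b * (k * l))) * (1 - U * (p * (a * b * (k * l))))).
Proof.
rewrite /down /shift /conn /y /z /tau.
have h : 1 - U * (p * (k * l)) * (a * b) != 0.
  by rewrite (_ : U * _ * _ = U * (p * (a * b * (k * l)))) //; ring.
by field; do ?[apply/andP; split].
Qed.

(** Coefficient of the mixed terms G (x) H + H (x) G, which must not survive. *)
Lemma addition_identity_cross :
  up * down / (k * l) + y * (shift * (1 - shift)) - z * conn ^+ 2 = 0.
Proof.
rewrite /up /down /shift /conn /y /z /tau.
have h : 1 - U * (p * (k * l)) * (a * b) != 0.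
  by rewrite (_ : U * _ * _ = U * (p * (a * b * (k * l)))) //; ring.
by field; do ?[apply/andP; split].
Qed.

End AdditionIdentities.

(** * Orthogonality *)

Section Orthogonality.
Context (R : realType) (q : R).
Local Notation C := R[i].
Local Notation Q := ((q ^+ 2)%:C : C).
Local Notation A := (zalg q).
Context (T : C).
Hypothesis q_gt0 : 0 < q.
Hypothesis q_lt1 : q < 1.
Hypothesis rT : regular Q T.

(** The squared norm h(R_(n,m) R_(m,n)), with h the coefficient of R_(0,0). *)
Definition weight (m n : nat) : C :=
  T ^+ n * (qp Q Q m * qp Q Q n) * (1 - T)
  / (qp Q T m * qp Q T n * (1 - T * Q ^+ (m + n))).

(** A balance condition: with these norms, left multiplications by z and z^* are adjoint to each
    other. [weight_down] is its other half. *)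
Lemma weight_up n m :
  weight n.+1 m * up_coef q T n m = down_coef_star q T n.+1 m * weight n m.
Proof.
rewrite /weight /up_coef /down_coef_star !qpS.
have := rT; move: (q ^+ 2)%:C => p h; rewrite -exprS addSn.
have := (h n, h m, h (n + m), h (n + m).+1, qp_neq0 n h, qp_neq0 m h)%N.
rewrite !exprS !exprD; move: (qp _ T _) (qp _ T _) (qp _ p _) (qp _ p _).
move: (p ^+ n) (p ^+ m) (T ^+ _) => a b t u v x y.
move=> [] [] [] [] [] ? ? ? ? ? ?.
by field; do ?[apply/andP; split].
Qed.

Lemma weight_down n m :
  weight n m * down_coef q T n m.+1 = up_coef_star q T n m * weight n m.+1.
Proof.
rewrite /weight /down_coef /up_coef_star !qpS.
have := rT; move: (q ^+ 2)%:C => p h; rewrite -exprS addnS.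
have := (h n, h m, h (n + m), h (n + m).+1, qp_neq0 n h, qp_neq0 m h)%N.
rewrite !exprS !exprD; move: (qp _ T _) (qp _ T _) (qp _ p _) (qp _ p _).
move: (p ^+ n) (p ^+ m) (T ^+ _) => a b t u v x y.
move=> [] [] [] [] [] ? ? ? ? ? ?.
by field; do ?[apply/andP; split].
Qed.

Local Notation cmod := (coef_module rT).

(** Orthogonality as an identity of functionals: x -> h(R_(m,n) x) is a multiple of one dual basis
    vector. The induction multiplies on the right because the right factor acts last, on a
    functional that is already known. *)
Lemma zact_zdisk_indic m n :
  zact (coef_gen q T) (coef_gen_star q T) (zdisk q T m n) (dual_basis R (0%N, 0%N))
  = weight n m *: dual_basis R (n, m).
Proof.
elim: m n => [|m IH] n.
  elim: n => [|n IH].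
    rewrite zdisk00 // (zact1 cmod) // /weight.
    rewrite !qp0 !expr0 !mulr1 mul1r divff ?scale1r //.
    by have := rT 0; rewrite expr0 mulr1.
  have -> : zdisk q T 0 n.+1 = zdisk q T 0 n * zgen_star q.
    by rewrite zdisk_mul_zs // up_coef0 // down_coef0 scale0r addr0 scale1r.
  rewrite (zactM cmod) // IH (zact_gen_star cmod) //.
  apply/funext => -[a b]; rewrite /coef_gen_star /dual_basis !fctE /=.
  rewrite -![_ *: _ : C^o]/(_ * _) !xpair_eqE.
  have -> : (b.+1 == 0)%N = false by [].
  rewrite andbF !mulr0 add0r; case: a => [|a] /=.
    by rewrite down_coef_star0 mul0r mulr0.
  case: (altP andP) => [[/eqP -> /eqP ->]|].
    have := weight_up n 0; rewrite up_coef0 // mulr1 => ->.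
    by rewrite /= mulr1.
  by rewrite /= !mulr0.
apply: (@scalerI _ _ (up_coef_star q T n m)).
  exact: up_coef_star_neq0.
rewrite -(zactZ cmod) //.
have -> : up_coef_star q T n m *: zdisk q T m.+1 n =
    zdisk q T m n * zgen q - down_coef_star q T n m *: zdisk q T m n.-1.
  by rewrite zdisk_mul_z // addrK.
rewrite (zactB cmod) // (zactM cmod) // (zactZ cmod) // !IH (zact_gen cmod) //.
apply/funext => -[a b]; rewrite /coef_gen /dual_basis !fctE /=.
rewrite -![_ *: _ : C^o]/(_ * _) !xpair_eqE.
rewrite [in RHS]mulrA -weight_down.
case: b => [|b] /=; first rewrite andbF down_coef0 mul0r addr0 mulr0.
  case: n => [|n] /=; first by rewrite down_coef_star0 /= !(mulr0, mul0r) subr0.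
  rewrite ?eqSS (mulrA (down_coef_star _ _ _ _)) -weight_up.
  case: eqP => [->|_]; case: eqP => [<-|_];
    rewrite /= ?mulr0 ?subr0 //.
  by rewrite !mulr1 mulrC subrr.
have -> : (a == n) && (b.+1 == m.+1) = (a == n) && (b == m) by [].
have -> : down_coef q T a b.+1 * (weight n m * ((a == n) && (b == m))%:R)
  = weight n m * down_coef q T n m.+1 * ((a == n) && (b == m))%:R.
  by case: andP => [[/eqP -> /eqP ->]|]; rewrite ?mulr0 // !mulr1 mulrC.
rewrite addrAC -[RHS]add0r; congr (_ + _).
case: n => [|n] /=; first by rewrite down_coef_star0 /= !(mulr0, mul0r) subr0.
rewrite ?eqSS (mulrA (down_coef_star _ _ _ _)) -weight_up.
case: (altP andP) => [[/eqP -> /eqP ->]|_].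
  by rewrite /= !mulr1 mulrC subrr.
by rewrite /= !mulr0 subr0.
Qed.

Lemma zcoef_zdiskM x y : zcoef T (0%N, 0%N) (zdisk q T x.1 x.2 * zdisk q T y.1 y.2)
  = weight x.2 x.1 * (y == (x.2, x.1))%:R.
Proof.
by case: y => m n; rewrite /zcoef (zactM cmod) // zact_zdisk_indic zact_zdisk.
Qed.

End Orthogonality.

(** * Adjoining a square root of 1 - z z^* to Z *)

Section SquareRoot.
Context (R : realType) (q : R).
Local Notation C := R[i].
Local Notation Q := ((q ^+ 2)%:C : C).
Local Notation c := (q%:C : C).
Local Notation A := (zalg q).
Local Notation V := (A * A)%type.
Local Notation z := (zgen q).
Local Notation zs := (zgen_star q).

Hypothesis q_gt0 : 0 < q.
Hypothesis q_lt1 : q < 1.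

Lemma c_neq0 : c != 0.
Proof. by rewrite fmorph_eq0 lt0r_neq0. Qed.

Lemma QcE : Q = c * c.
Proof. by rewrite -rmorphM expr2. Qed.

Definition sigma_gen (v : A) : A := v * (c *: z).
Definition sigma_gen_star (v : A) : A := v * (c^-1 *: zs).

Lemma sigma_module : right_zmodule q sigma_gen sigma_gen_star (fun=> True).
Proof.
split=> // [a u v|a u v|v _]; rewrite /sigma_gen /sigma_gen_star.
- by rewrite mulrDl scalerAl.
- by rewrite mulrDl scalerAl.
- have h (x y : A) : v * (c^-1 *: x) * (c *: y) = v * (x * y).
    rewrite -!scalerAr -scalerAl scalerA mulfV ?c_neq0 // scale1r.
    by rewrite mulrA.
  have h' (x y : A) : v * (c *: x) * (c^-1 *: y) = v * (x * y).
    rewrite -!scalerAr -scalerAl scalerA mulVf ?c_neq0 // scale1r.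
    by rewrite mulrA.
  by rewrite h h' zs_z mulrDr -!scalerAr mulr1.
Qed.

Definition sigma (x : A) : A := zact sigma_gen sigma_gen_star x 1.

Lemma sigmaE x v : zact sigma_gen sigma_gen_star x v = v * sigma x.
Proof.
rewrite /sigma /zact; elim: (repr x) v => [a|||t IHt u IHu|t IHt u IHu] v /=.
- by rewrite -scalerAr mulr1.
- by rewrite /sigma_gen mul1r.
- by rewrite /sigma_gen_star mul1r.
- by rewrite IHt IHu -mulrDr.
- by rewrite IHt IHu (IHu (zterm_act _ _ _ _)) mulrA.
Qed.

Lemma sigma1 : sigma 1 = 1.
Proof. exact: (zact1 sigma_module). Qed.

Lemma sigmaD x y : sigma (x + y) = sigma x + sigma y.
Proof. exact: (zactD sigma_module). Qed.

Lemma sigmaB x y : sigma (x - y) = sigma x - sigma y.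
Proof. exact: (zactB sigma_module). Qed.

Lemma sigmaZ a x : sigma (a *: x) = a *: sigma x.
Proof. exact: (zactZ sigma_module). Qed.

Lemma sigmaM x y : sigma (x * y) = sigma x * sigma y.
Proof. by rewrite {1}/sigma (zactM sigma_module) // sigmaE. Qed.

Lemma sigma_z : sigma z = c *: z.
Proof. by rewrite /sigma (zact_gen sigma_module) // /sigma_gen mul1r. Qed.

Lemma sigma_zs : sigma zs = c^-1 *: zs.
Proof.
by rewrite /sigma (zact_gen_star sigma_module) // /sigma_gen_star mul1r.
Qed.

Lemma sigma_zx : sigma (zx q) = zx q.
Proof.
rewrite zxE sigmaB sigma1 sigmaM sigma_z sigma_zs -scalerAl -scalerAr scalerA.
by rewrite mulfV ?scale1r // c_neq0.
Qed.

(** Consistency of s u = sigma(u) s with s^2 = 1 - z z^*: both sides are s^2 u. *)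
Lemma sigma_sigma x : sigma (sigma x) * zx q = zx q * x.
Proof.
elim/zalg_ind: x => t; elim: t => [a|||t IHt u IHu|t IHt u IHu].
- have -> : zclass q (ZConst a) = a *: 1 by rewrite -[RHS]/(zmul _ _) zmul1r.
  by rewrite !sigmaZ !sigma1 -scalerAl -scalerAr mul1r mulr1.
- rewrite -/z sigma_z sigmaZ sigma_z scalerA -QcE -scalerAl.
  by rewrite zx_z.
- rewrite -/zs sigma_zs sigmaZ sigma_zs scalerA -invfM -QcE -scalerAl.
  by rewrite zs_zx scalerA mulVf ?scale1r // Q_neq0.
- have -> : zclass q (ZAdd t u) = zclass q t + zclass q u by rewrite -zclassD.
  by rewrite !sigmaD mulrDl mulrDr IHt IHu.
- have -> : zclass q (ZMul t u) = zclass q t * zclass q u by rewrite -zclassM.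
  by rewrite !sigmaM -mulrA IHu mulrA IHt mulrA.
Qed.

(* The left module Z + Z s, where s is a square root of 1 - z z^* such that
   s u = sigma(u) s; a pair (a, b) stands for a + b s. *)
Definition smul (v : V) : V := (sigma v.2 * zx q, sigma v.1).
Definition zmulV (u : A) (v : V) : V := (u * v.1, u * v.2).

Lemma zmulVA u v w : zmulV u (zmulV v w) = zmulV (u * v) w.
Proof. by rewrite /zmulV !mulrA. Qed.

Lemma zmulVDl u v w : zmulV (u + v) w = zmulV u w + zmulV v w.
Proof. by rewrite /zmulV !mulrDl. Qed.

Lemma zmulVZl a u w : zmulV (a *: u) w = a *: zmulV u w.
Proof. by rewrite /zmulV -!scalerAl. Qed.

Lemma zmulVZr a u w : zmulV u (a *: w) = a *: zmulV u w.
Proof. by rewrite /zmulV /= -!scalerAr. Qed.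

Lemma zmulVDr u v w : zmulV u (v + w) = zmulV u v + zmulV u w.
Proof. by rewrite /zmulV !mulrDr. Qed.

Lemma zmul1V v : zmulV 1 v = v.
Proof. by case: v => a b; rewrite /zmulV !mul1r. Qed.

Lemma smulD v w : smul (v + w) = smul v + smul w.
Proof. by rewrite /smul !sigmaD mulrDl. Qed.

Lemma smulZ a v : smul (a *: v) = a *: smul v.
Proof. by rewrite /smul !sigmaZ -scalerAl. Qed.

Lemma smul_z v : smul (zmulV z v) = c *: zmulV z (smul v).
Proof. by rewrite -zmulVZl /smul /zmulV !sigmaM sigma_z mulrA. Qed.

Lemma smul_zs v : smul (zmulV zs v) = c^-1 *: zmulV zs (smul v).
Proof. by rewrite -zmulVZl /smul /zmulV !sigmaM sigma_zs mulrA. Qed.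

Lemma smul_smul v : smul (smul v) = zmulV (zx q) v.
Proof.
by case: v => a b; rewrite /smul /zmulV /= sigmaM sigma_zx !sigma_sigma.
Qed.

(** Left multiplication by s^j u, the shape of every f_(k,l). *)
Definition fop (j : nat) (u : A) (v : V) : V := iter j smul (zmulV u v).

Lemma fopDl j u v w : fop j (u + v) w = fop j u w + fop j v w.
Proof.
rewrite /fop zmulVDl; elim: j => // j IH.
by rewrite !iterS IH smulD.
Qed.

Lemma fopZl j a u w : fop j (a *: u) w = a *: fop j u w.
Proof.
rewrite /fop zmulVZl; elim: j => // j IH.
by rewrite !iterS IH smulZ.
Qed.

Lemma fopBl j u v w : fop j (u - v) w = fop j u w - fop j v w.
Proof. by rewrite -scaleN1r fopDl fopZl scaleN1r. Qed.

Lemma fop_zx j u v : smul (fop j.+1 u v) = fop j (zx q * u) v.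
Proof.
by rewrite /fop -iterS !iterSr smul_smul zmulVA.
Qed.

Lemma zmulV_fop j u v : zmulV z (fop j u v) = c ^- j *: fop j (z * u) v.
Proof.
rewrite /fop -zmulVA; elim: j => [|j IH] /=.
  by rewrite expr0 invr1 scale1r.
apply: (scalerI c_neq0); rewrite -smul_z IH smulZ scalerA exprS invfM mulrA.
by rewrite mulfV ?mul1r // c_neq0.
Qed.

Lemma zmulV_star_fop j u v :
  zmulV zs (fop j u v) = c ^+ j *: fop j (zs * u) v.
Proof.
rewrite /fop -zmulVA; elim: j => [|j IH] /=.
  by rewrite expr0 scale1r.
apply: (@scalerI _ _ c^-1); first by rewrite invr_eq0 c_neq0.
rewrite -smul_zs IH smulZ scalerA exprS mulrA.
by rewrite mulVf ?mul1r // c_neq0.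
Qed.

Definition bilinear_form (b : V -> V -> C) :=
  (forall a u v w, b (a *: u + v) w = a * b u w + b v w) /\
  (forall a u v w, b w (a *: u + v) = a * b w u + b w v).

Section Bilinear.
Context (b : V -> V -> C) (Hb : bilinear_form b).

Lemma bilinear_comb a d (G H G' H' : V) :
  b (a *: G + d *: H) (a *: G' + d *: H') =
  a ^+ 2 * b G G' + a * d * (b G H' + b H G') + d ^+ 2 * b H H'.
Proof.
have [b1 b2] := Hb.
have b10 w : b 0 w = 0 
  by have := b1 (-1) 0 0 w; rewrite scaleN1r oppr0 addr0 mulN1r addNr.
have b20 w : b w 0 = 0 
  by have := b2 (-1) 0 0 w; rewrite scaleN1r oppr0 addr0 mulN1r addNr.
have b1Z e u w : b (e *: u) w = e * b u w by rewrite -[e *: u]addr0 b1 b10 addr0.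
have b2Z e u w : b w (e *: u) = e * b w u by rewrite -[e *: u]addr0 b2 b20 addr0.
rewrite b1 b1Z !b2 !b2Z.
by ring.
Qed.

Lemma bilinear_scale a (G G' : V) : b (a *: G) (a *: G') = a ^+ 2 * b G G'.
Proof.
have := bilinear_comb a 0 G 0 G' 0; rewrite !scale0r !addr0.
by rewrite mulr0 mul0r expr0n mul0r !addr0.
Qed.

End Bilinear.
End SquareRoot.

(** * The addition formula *)

Section AdditionStep.
Context (R : realType) (q : R).
Local Notation C := R[i].
Local Notation Q := ((q ^+ 2)%:C : C).
Local Notation c := (q%:C : C).
Local Notation A := (zalg q).
Local Notation V := (A * A)%type.
Local Notation z := (zgen q).
Local Notation zs := (zgen_star q).
Context (U : C).
Local Notation T := (U * Q).
Local Notation addc := (addition_coef Q c U).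

Hypothesis q_gt0 : 0 < q.
Hypothesis q_lt1 : q < 1.
Hypothesis rU : regular Q U.

Let rQ : regular Q Q. Proof. exact: regular_Q. Qed.
Let Qn0 : Q != 0. Proof. exact: Q_neq0. Qed.
Let cn0 : c != 0. Proof. exact: c_neq0. Qed.
Let rT j : regular Q (T * Q ^+ j).
Proof. by rewrite -mulrA -exprS; exact: regularM. Qed.

(** Extended by 0, so that sums may run over any large enough box. Here U belongs to alpha - 1 and T
    = U Q to alpha; [zadd_fun] below is multiplication by f_(k,l). *)
Definition zadd_coef (m n k l : nat) : C :=
  if (k <= m)%N && (l <= n)%N then addc (m - k) k (n - l) l else 0.

Definition zadd_fun (m n k l : nat) : V -> V :=
  fop (k + l) (zdisk q (T * Q ^+ (k + l)) (m - k) (n - l)).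

(** This and the next three lemmas factor out one c_(k,l) and leave a quotient in the form used by
    the scalar identities. *)
Lemma addition_y M k N l :
  c * (addc M.+1 k N l * up_coef q U k l) = addc M k.+1 N l *
   (Q * Q ^+ M * (1 - Q ^+ k.+1) * (1 - U * (Q ^+ k.+1 * Q ^+ l))
         / (Q ^+ k.+1 * Q ^+ l * (1 - Q * Q ^+ M)
            * (1 - U * (Q ^+ N * (Q ^+ k.+1 * Q ^+ l))))).
Proof.
rewrite addition_coef_Pk // /up_coef.
move: (addc _ _ _ _) cn0 => X; move: c => d dn0.
have := (subQS_neq0 rQ M, rU k, rU (k + l), rU (k + l).+1, rU (N + (k + l)).+1)%N.
have := (expf_neq0 k Qn0, expf_neq0 l Qn0); move: Qn0.
move: (q ^+ 2)%:C => p; rewrite !exprS !exprD.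
move: (p ^+ k) (p ^+ l) (p ^+ N) (p ^+ M) => k' l' n' m'.
move=> ? [] ? ? [] [] [] [] ? ? ? ? h.
have h' : 1 - U * (n' * (p * k' * l')) != 0.
  by rewrite (_ : n' * _ = p * (n' * (k' * l'))) //; ring.
by field; do ?[apply/andP; split].
Qed.

Lemma addition_z M k N l :
  c * (addc M k N l.+1 * down_coef q U k l.+1) = addc M k N.+1 l *
    (Q * U * Q ^+ k * (1 - Q ^+ N.+1) * (1 - U * (Q * (Q ^+ M * (Q ^+ k * Q ^+ l))))
     * (1 - U * Q ^+ l)
     / (Q ^+ M * (1 - U * (Q ^+ k * Q ^+ l))
        * (1 - U * (Q * (Q ^+ k * Q ^+ l))) ^+ 2)).
Proof.
rewrite addition_coef_Sl // /down_coef.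
move: (addc _ _ _ _) cn0 (@QcE R q) => X; move: c => d dn0.
have := (subQS_neq0 rQ l, rU (k + l), rU (k + l).+1)%N.
have := (expf_neq0 M Qn0); move: Qn0.
move: (q ^+ 2)%:C => p; rewrite addnS !exprS !exprD.
move: (p ^+ k) (p ^+ l) (p ^+ N) (p ^+ M) => k' l' n' m'.
move=> h1 h2 [] [] h3 h4 h5 pE; rewrite pE in h1 h3 h4 h5 *.
by field; do ?[apply/andP; split].
Qed.

Lemma addition_up M k N l :
  up_coef q T (M + k) (N + l) * addc M.+1 k N l = addc M k N l *
  ((1 - Q * (Q ^+ M * Q ^+ k)) * (1 - U * (Q * (Q ^+ M * (Q ^+ k * Q ^+ l))))
  / (Q ^+ k * Q ^+ l * (1 - Q * Q ^+ M)
     * (1 - U * (Q * (Q ^+ M * Q ^+ N * (Q ^+ k * Q ^+ l)))))).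
Proof.
rewrite addition_coef_SM // /up_coef.
have := (subQS_neq0 rQ M, rU (M + k).+1, rU (M + k + (N + l)).+1)%N.
have := (expf_neq0 k Qn0, expf_neq0 l Qn0).
move: (addc _ _ _ _) => X.
move: (q ^+ 2)%:C => p; rewrite !exprS !exprD.
move: (p ^+ k) (p ^+ l) (p ^+ N) (p ^+ M) => k' l' n' m'.
move=> [] ? ? [] [] ? ? h.
have h' : 1 - U * (p * (m' * n' * (k' * l'))) != 0.
  by rewrite (_ : m' * n' * _ = m' * k' * (n' * l')) //; ring.
have h2 : 1 - U * p * (m' * k' * (n' * l')) != 0 by rewrite -mulrA.
have h3 : 1 - U * p * (m' * k') != 0 by rewrite -mulrA.
by field; do ?[apply/andP; split].
Qed.

Lemma addition_down M k N l :
  down_coef q T (M + k) (N.+1 + l) * addc M k N l = addc M k N.+1 l *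
  (U * (Q * (Q ^+ M * Q ^+ k)) * (1 - Q ^+ N.+1) * (1 - U * (Q ^+ N.+1 * Q ^+ l))
  / ((1 - U * (Q ^+ N.+1 * (Q ^+ k * Q ^+ l)))
     * (1 - U * (Q * (Q ^+ M * Q ^+ N.+1 * (Q ^+ k * Q ^+ l)))))).
Proof.
rewrite addition_coef_PN // /down_coef.
have := (subQS_neq0 rQ (N + l), rU (N + (k + l)).+1, rU (M + k + (N.+1 + l)).+1)%N.
move: (addc _ _ _ _) => X.
move: (q ^+ 2)%:C => p; rewrite !addSn !addnS !exprS !exprD.
move: (p ^+ k) (p ^+ l) (p ^+ N) (p ^+ M) => k' l' n' m'.
move=> [] [] ? h1 h.
have h1' : 1 - U * (p * n' * (k' * l')) != 0 by rewrite -(mulrA p).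
have h' : 1 - U * (p * (m' * (p * n') * (k' * l'))) != 0.
  by rewrite (_ : _ * _ * (_ * _) = p * (m' * k' * (n' * l'))) //; ring.
have h2 : 1 - U * p * (p * (m' * k' * (n' * l'))) != 0 by rewrite -mulrA.
by field; do ?[apply/andP; split].
Qed.

(** The new top index k = m + 1: no f_(m+1,l) exists for R_(m,n), so only s f_(m,l) contributes. *)
Lemma addition_edge m N l :
  c * (addc 0 m N l * up_coef q U m l) =
  up_coef q T m (N + l) * addc 0 m.+1 N l.
Proof.
have := addition_coef_Pk Qn0 cn0 rQ rU 0 m N l; rewrite addition_coef_SM //.
rewrite expr0 !add0n expr1 /up_coef.
have := (subQS_neq0 rQ m, subQS_neq0 rQ 0, rU m, rU m.+1, rU (m + l))%N.
have := (rU (m + l).+1, rU (N + (m + l)).+1, expf_neq0 m Qn0, expf_neq0 l Qn0)%N.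
have := rU (m + (N + l)).+1; rewrite expr1.
move: (addc _ _ _ _) (addc _ _ _ _) cn0 => Y X; move: c => d dn0.
move: Qn0; move: (q ^+ 2)%:C => p p0; rewrite !exprS !exprD.
move: (p ^+ l) (p ^+ N) (p ^+ m) => l' n' m'.
move=> h [] [] [] h1 h2 h3 h4 [] [] [] [] h5 h6 h7 h8 h9 e.
have h' : 1 - U * (p * (n' * (m' * l'))) != 0.
  by rewrite (_ : n' * _ = m' * (n' * l')) //; ring.
have h2' : 1 - U * p * (m' * (n' * l')) != 0 by rewrite -mulrA.
have h3' : 1 - U * p * m' != 0 by rewrite -mulrA.
have h5' : 1 - p * m' != 0 by [].
(* The first factor is the left side of [e]; the second undoes what [addition_coef_SM]
   introduced. *)
transitivity (X / (m' * l') * ((1 - p * m') * (1 - U * (p * (m' * l'))))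
    / ((1 - p) * (1 - U * (p * m')))
    * (m' * l' * (1 - p) * (1 - U * (p * m')) * d * (1 - U * m')
       / ((1 - p * m') * (1 - U * (p * (m' * l'))) * (1 - U * (m' * l'))))).
  by field; do ?[apply/andP; split].
rewrite e.
by field; do ?[apply/andP; split].
Qed.

Lemma shift_coefE M N k l :
  shift_coef Q (U * Q * Q ^+ (k + l)) M.+1 N =
  (1 - U * (Q * (Q ^+ k.+1 * Q ^+ l)) * Q ^+ M)
  * (1 - U * (Q ^+ N * (Q ^+ k.+1 * Q ^+ l)))
  / ((1 - U * (Q ^+ k.+1 * Q ^+ l))
     * (1 - U * (Q * (Q ^+ k.+1 * Q ^+ l)) * (Q ^+ M * Q ^+ N))).
Proof.
rewrite /shift_coef -!(mulrA U) -exprD addSn !exprS !exprD; congr (_ / _).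
  by congr ((1 - U * _) * (1 - U * _)); ring.
by congr (_ * (1 - U * _)); ring.
Qed.

Lemma zadd_fun_z M k N l v :
  zmulV z (zadd_fun (M + k) (N + l) k l v) =
  c ^- (k + l) *: (up_coef q (T * Q ^+ (k + l)) M N
                     *: fop (k + l) (zdisk q (T * Q ^+ (k + l)) M.+1 N) v
                   + down_coef q (T * Q ^+ (k + l)) M N
                     *: fop (k + l) (zdisk q (T * Q ^+ (k + l)) M N.-1) v).
Proof.
by rewrite /zadd_fun !addnK zmulV_fop // mul_z_zdisk // fopDl // !fopZl.
Qed.

(** The power of s becomes that of f_(k+1,l), so the connection formula raises the parameter to
    match. *)
Lemma zadd_fun_s1 M k N l v :
  smul (zadd_fun (M + k.+1) (N + l) k l v) =
  let s := shift_coef Q (T * Q ^+ (k + l)) M.+1 N in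
  s *: fop (k.+1 + l) (zdisk q (T * Q ^+ (k.+1 + l)) M.+1 N) v
  + (1 - s) *: fop (k.+1 + l) (zdisk q (T * Q ^+ (k.+1 + l)) M N.-1) v.
Proof.
have -> : T * Q ^+ (k.+1 + l) = T * Q ^+ (k + l) * Q.
  by rewrite addSn (exprSr Q) mulrA.
rewrite /zadd_fun addnK (addnS M) -(addSn M) addnK zdisk_shift // addSn.
by rewrite -!fopZl // -fopDl.
Qed.

Definition step_G M k N l : V -> V :=
  fop (k + l) (zdisk q (T * Q ^+ (k + l)) M.+1 N).

Definition step_H M k N l : V -> V :=
  fop (k + l) (zdisk q (T * Q ^+ (k + l)) M N.-1).

Definition step_shift M k N l : C :=
  (1 - U * (Q * (Q ^+ k * Q ^+ l)) * Q ^+ M)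
  * (1 - U * (Q ^+ N * (Q ^+ k * Q ^+ l)))
  / ((1 - U * (Q ^+ k * Q ^+ l))
     * (1 - U * (Q * (Q ^+ k * Q ^+ l)) * (Q ^+ M * Q ^+ N))).

Definition step_conn M k N l : C :=
  (1 - U * (Q * (Q ^+ k * Q ^+ l))) * Q ^+ M
  / (1 - U * (Q * (Q ^+ k * Q ^+ l)) * (Q ^+ M * Q ^+ N)).

Definition step_y M k N l : C :=
  Q * Q ^+ M * (1 - Q ^+ k) * (1 - U * (Q ^+ k * Q ^+ l))
  / (Q ^+ k * Q ^+ l * (1 - Q * Q ^+ M)
     * (1 - U * (Q ^+ N * (Q ^+ k * Q ^+ l)))).

Definition step_z M k N l : C :=
  Q * U * Q ^+ k * (1 - Q ^+ N) * (1 - U * (Q * (Q ^+ M * (Q ^+ k * Q ^+ l))))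
  * (1 - U * Q ^+ l)
  / (Q ^+ M * (1 - U * (Q ^+ k * Q ^+ l))
     * (1 - U * (Q * (Q ^+ k * Q ^+ l))) ^+ 2).

(** Here two powers of s too many give a factor s^2 = x, which [zx_zdisk] absorbs while lowering the
    parameter; the result is a multiple of H - G. *)
Lemma zadd_fun_s2 M k N l v :
  smul (zadd_fun (M + k) (N.+1 + l) k l.+1 v) =
  (- step_conn M k N.+1 l) *: step_G M k N.+1 l v
  + step_conn M k N.+1 l *: step_H M k N.+1 l v.
Proof.
have -> : step_conn M k N.+1 l =
    (1 - T * Q ^+ (k + l)) * Q ^+ M / (1 - T * Q ^+ (k + l) * Q ^+ (M + N).+1).
  by rewrite /step_conn -!(mulrA U) -!exprD addnS.
rewrite /zadd_fun addnK addSnnS addnK addnS fop_zx //.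
rewrite (exprSr Q) (mulrA T) zx_zdisk //.
rewrite fopZl //.
rewrite fopBl //.
rewrite scalerBr.
rewrite scaleNr.
by rewrite addrC.
Qed.

Section Step.
Context (b : V -> V -> C) (Hb : bilinear_form b) (v v' : V).

Definition addition_term (m n k l : nat) : C :=
  zadd_coef m n k l * b (zadd_fun m n k l v) (zadd_fun m n k l v').

Definition step_z_term (m n k l : nat) : C :=
  zadd_coef m n k l * b (zmulV z (zadd_fun m n k l v))
                        (zmulV z (zadd_fun m n k l v')).

(** The factor [r] is the coefficient with which z R_(k,l)^(alpha - 1) reaches a neighbouring
    index. *)
Definition step_s_term (m n k l : nat) (r : C) : C :=
  c * (zadd_coef m n k l * r) * b (smul (zadd_fun m n k l v))
                                  (smul (zadd_fun m n k l v')).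

Lemma step_z_termE M k N l :
  let t := U * (Q * (Q ^+ k * Q ^+ l)) in
  let up := (1 - t * Q ^+ M) / (1 - t * (Q ^+ M * Q ^+ N)) in
  let dn := t * Q ^+ M * (1 - Q ^+ N) / (1 - t * (Q ^+ M * Q ^+ N)) in
  let G := step_G M k N l in let H := step_H M k N l in
  step_z_term (M + k) (N + l) k l = addc M k N l *
    ((up ^+ 2 * b (G v) (G v') + up * dn * (b (G v) (H v') + b (H v) (G v'))
      + dn ^+ 2 * b (H v) (H v')) / (Q ^+ k * Q ^+ l)).
Proof.
move=> t up dn G H; rewrite /step_z_term /zadd_coef !leq_addl !addnK.
congr (_ * _).
rewrite !zadd_fun_z (bilinear_scale Hb) (bilinear_comb Hb).
have tE : T * Q ^+ (k + l) = t by rewrite exprD -mulrA.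
rewrite /up_coef /down_coef -/(step_G M k N l) -/(step_H M k N l) tE.
rewrite !(exprD Q) -/up -/dn mulrC.
congr (_ * _); rewrite exprVn; congr (_^-1).
by rewrite -exprM mulnC exprM expr2 -QcE exprD.
Qed.

Lemma step_s_term_up M k N l :
  let s := step_shift M k.+1 N l in
  let G := step_G M k.+1 N l in let H := step_H M k.+1 N l in
  step_s_term (M + k.+1) (N + l) k l (up_coef q U k l) =
  addc M k.+1 N l * (step_y M k.+1 N l *
    (s ^+ 2 * b (G v) (G v') + s * (1 - s) * (b (G v) (H v') + b (H v) (G v'))
     + (1 - s) ^+ 2 * b (H v) (H v'))).
Proof.
move=> s G H; rewrite /step_s_term /zadd_coef leq_addl addnS -addSn leq_addl.
rewrite !addnK addition_y // addSn -addnS !zadd_fun_s1 /= shift_coefE.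
by rewrite (bilinear_comb Hb) [RHS]mulrA.
Qed.

Lemma step_s_term_down M k N l :
  let d := step_conn M k N l in
  let G := step_G M k N l in let H := step_H M k N l in
  step_s_term (M + k) (N + l) k l.+1 (down_coef q U k l.+1) =
  addc M k N l * (step_z M k N l * (d ^+ 2 *
    (b (G v) (G v') - (b (G v) (H v') + b (H v) (G v')) + b (H v) (H v')))).
Proof.
rewrite /step_s_term /zadd_coef /=; case: N => [|N].
  rewrite add0n ltnn andbF /step_z expr0 subrr.
  by rewrite !(mulr0, mul0r).
rewrite leq_addl addSnnS leq_addl !addnK addition_z -addSnnS !zadd_fun_s2.
rewrite (bilinear_comb Hb) -/(step_z M k N.+1 l).
have alg (X Y d g1 g2 g3 : C) :
    X * Y * ((- d) ^+ 2 * g1 + - d * d * g2 + d ^+ 2 * g3)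
    = X * (Y * (d ^+ 2 * (g1 - g2 + g3))) by ring.
exact: alg.
Qed.

(** The coefficient of R_(k,l)^(alpha - 1) in Phi(z) Phi(R_(m,n)): it is fed by (k,l) through z (x)
    z (x) 1, and by (k-1,l) and (k,l+1) through q s (x) s (x) z. *)
Lemma addition_step M k N l :
  step_z_term (M + k) (N + l) k l
  + (if k is k'.+1 then
       step_s_term (M + k) (N + l) k' l (up_coef q U k' l) else 0)
  + step_s_term (M + k) (N + l) k l.+1 (down_coef q U k l.+1)
  = up_coef q T (M + k) (N + l) * addition_term (M + k).+1 (N + l) k l
    + down_coef q T (M + k) (N + l) * addition_term (M + k) (N + l).-1 k l.
Proof.
have f1 w : zadd_fun (M + k).+1 (N + l) k l w = step_G M k N l w.
  by rewrite /zadd_fun -addSn !addnK.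
have f2 w : zadd_fun (M + k) (N + l).-1 k l w = step_H M k N l w.
  by rewrite /zadd_fun addnK -subn1 subnAC addnK subn1.
pose gg := b (step_G M k N l v) (step_G M k N l v').
pose hh := b (step_H M k N l v) (step_H M k N l v').
pose gh := b (step_G M k N l v) (step_H M k N l v')
           + b (step_H M k N l v) (step_G M k N l v').
pose s := step_shift M k N l; pose d := step_conn M k N l.
have E2 : (if k is k'.+1 then
       step_s_term (M + k) (N + l) k' l (up_coef q U k' l) else 0) =
    addc M k N l * (step_y M k N l *
      (s ^+ 2 * gg + s * (1 - s) * gh + (1 - s) ^+ 2 * hh)).
  rewrite /s /gg /gh /hh; case: (k) => [|k']; last exact: step_s_term_up.
  by rewrite /step_y expr0 subrr !(mulr0, mul0r).
rewrite {}E2 step_s_term_down step_z_termE -/gg -/gh -/hh -/d.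
rewrite /addition_term !f1 !f2 -/gg -/hh.
have -> : zadd_coef (M + k).+1 (N + l) k l = addc M.+1 k N l.
  by rewrite /zadd_coef -addSn !leq_addl !addnK.
rewrite [in RHS]mulrA addition_up.
have -> : down_coef q T (M + k) (N + l) * (zadd_coef (M + k) (N + l).-1 k l * hh)
  = addc M k N l * (U * (Q * (Q ^+ M * Q ^+ k)) * (1 - Q ^+ N)
      * (1 - U * (Q ^+ N * Q ^+ l))
      / ((1 - U * (Q ^+ N * (Q ^+ k * Q ^+ l)))
         * (1 - U * (Q * (Q ^+ M * Q ^+ N * (Q ^+ k * Q ^+ l)))))) * hh.
  rewrite mulrA; congr (_ * _); rewrite /zadd_coef leq_addl addnK.
  case: (N) => [|N'].
    rewrite expr0 subrr !(mulr0, mul0r); case: (l) => [|l'].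
      by rewrite down_coef0 mul0r.
    by rewrite /= ltnn mulr0.
  by rewrite addSn /= leq_addl addnK -addSn addition_down.
have ne k0 := rU k0.
have nQ k0 : Q ^+ k0 != 0 by exact: expf_neq0.
have n1 : 1 - Q * Q ^+ M != 0 by exact: rQ.
have n2 : 1 - U * (Q ^+ k * Q ^+ l) != 0 by rewrite -exprD.
have n3 : 1 - U * (Q * (Q ^+ k * Q ^+ l)) != 0 by rewrite -exprD -exprS.
have n4 : 1 - U * (Q ^+ N * (Q ^+ k * Q ^+ l)) != 0 by rewrite -!exprD.
have n5 : 1 - U * (Q * (Q ^+ M * Q ^+ N * (Q ^+ k * Q ^+ l))) != 0.
  by rewrite -!exprD -exprS.
rewrite -(addition_identity_up (nQ M) (nQ k) (nQ l) n1 n2 n3 n4 n5).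
rewrite -(addition_identity_down (nQ M) (nQ k) (nQ l) n1 n2 n3 n4 n5).
have := addition_identity_cross (nQ M) (nQ k) (nQ l) n1 n2 n3 n4 n5.
rewrite -/(step_y M k N l) -/(step_z M k N l) -/(step_shift M k N l).
rewrite -/(step_conn M k N l) -/s -/d.
set up := (1 - _) / _; set dn := _ * (1 - Q ^+ N) / _.
move: (step_y M k N l) (step_z M k N l) (addc M k N l) gg gh hh s d up dn.
move: (Q ^+ k * Q ^+ l) => kl y0 z0 X gg gh hh s d up dn e.
(* The two sides differ by [X * gh] times the cross identity. *)
rewrite -[RHS]addr0 -(mulr0 (X * gh)) -e.
by ring.
Qed.

End Step.

End AdditionStep.

(** * Phi as an action on trilinear forms, and the induction on m and n *)

Section AdditionFormula.
Context (R : realType) (q : R).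
Local Notation C := R[i].
Local Notation Q := ((q ^+ 2)%:C : C).
Local Notation c := (q%:C : C).
Local Notation A := (zalg q).
Local Notation V := (A * A)%type.
Local Notation z := (zgen q).
Local Notation zs := (zgen_star q).
Context (U : C).
Local Notation T := (U * Q).
Local Notation addc := (addition_coef Q c U).

Hypothesis q_gt0 : 0 < q.
Hypothesis q_lt1 : q < 1.
Hypothesis rU : regular Q U.

Let rQ : regular Q Q. Proof. exact: regular_Q. Qed.
Let Qn0 : Q != 0. Proof. exact: Q_neq0. Qed.
Let cn0 : c != 0. Proof. exact: c_neq0. Qed.
Let rT j : regular Q (T * Q ^+ j).
Proof. by rewrite -mulrA -exprS; exact: regularM. Qed.
Let rT0 : regular Q T.
Proof. by have := rT 0; rewrite expr0 mulr1. Qed.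

Lemma zadd_coef_eq0 m n k l : ~~ ((k <= m)%N && (l <= n)%N) ->
  zadd_coef q U m n k l = 0.
Proof. by rewrite /zadd_coef => /negPf ->. Qed.

Section InductionStep.
Context (b : V -> V -> C) (Hb : bilinear_form b) (v v' : V).
Local Notation zterm := (step_z_term U b v v').
Local Notation sterm := (step_s_term U b v v').
Local Notation aterm := (addition_term U b v v').

Lemma addition_step_edge m N l :
  sterm m (N + l) m l (up_coef q U m l)
  = up_coef q T m (N + l) * aterm m.+1 (N + l) m.+1 l.
Proof.
rewrite /step_s_term /addition_term /zadd_coef !leqnn !leq_addl /= !subnn !addnK.
have h (w : V) : smul (zadd_fun U m (N + l) m l w) = zadd_fun U m.+1 (N + l) m.+1 l w.
  rewrite /zadd_fun !subnn !addnK (zdisk_shift0 q_gt0).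
  have -> : T * Q ^+ (m + l) * Q = T * Q ^+ (m.+1 + l).
    by rewrite addSn (exprSr Q) mulrA.
  by [].
rewrite !h (mulrA (up_coef _ _ _ _)); congr (_ * _).
exact: addition_edge.
Qed.

Lemma step_z_term0 m n k l :
  ~~ ((k <= m)%N && (l <= n)%N) -> zterm m n k l = 0.
Proof. by move=> h; rewrite /step_z_term zadd_coef_eq0 // mul0r. Qed.

Lemma step_s_term0 m n k l r :
  ~~ ((k <= m)%N && (l <= n)%N) -> sterm m n k l r = 0.
Proof.
by move=> h; rewrite /step_s_term zadd_coef_eq0 // (mul0r r) mulr0 mul0r.
Qed.

Lemma addition_term0 m n k l :
  ~~ ((k <= m)%N && (l <= n)%N) -> aterm m n k l = 0.
Proof. by move=> h; rewrite /addition_term zadd_coef_eq0 // mul0r. Qed.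

(** Valid for all k and l, inside or outside the range, so that sums over a fixed box can be
    compared termwise. *)
Lemma addition_step_all m n k l :
  zterm m n k l
  + (if k is k'.+1 then sterm m n k' l (up_coef q U k' l) else 0)
  + sterm m n k l.+1 (down_coef q U k l.+1)
  = up_coef q T m n * aterm m.+1 n k l + down_coef q T m n * aterm m n.-1 k l.
Proof.
have [ln|nl] := leqP l n; last first.
  have h m' n' k' l' : (n' <= n)%N -> (l <= l')%N ->
      ~~ ((k' <= m')%N && (l' <= n')%N).
    move=> n'n ll'; rewrite negb_and -!ltnNge.
    by rewrite (leq_ltn_trans n'n (leq_trans nl ll')) orbT.
  rewrite step_z_term0 ?h // step_s_term0 ?h // !addition_term0 ?h ?leq_pred //.
  rewrite !mulr0; case: k => [|k]; last rewrite step_s_term0 ?h //.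
    by rewrite !addr0.
  by rewrite !addr0.
rewrite -(subnK ln); move: (n - l)%N => N {ln}.
have [km|] := leqP k m.
  by rewrite -(subnK km) addition_step.
case: k => // k; rewrite ltnS => mk.
rewrite step_z_term0; last by rewrite negb_and -ltnNge ltnS mk.
rewrite (@step_s_term0 _ _ k.+1); last by rewrite negb_and -ltnNge ltnS mk.
rewrite (@addition_term0 m); last by rewrite negb_and -ltnNge ltnS mk.
rewrite mulr0 add0r !addr0.
move: mk; rewrite leq_eqVlt => /orP[/eqP <-|mk]; first exact: addition_step_edge.
rewrite step_s_term0; last by rewrite negb_and -ltnNge mk.
by rewrite addition_term0 ?mulr0 // negb_and -ltnNge ltnS mk.
Qed.

(** A q-binomial coefficient times q^l. *)
Lemma addition_coef00 N l :
  addc 0 0 N l = c ^+ l * (qp Q Q (N + l) / (qp Q Q l * qp Q Q N)).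
Proof.
rewrite /addition_coef !add0n mul0n expr0 !qp0 (qpS _ _ 0) qp0 expr0.
have := (qp_neq0 l rQ, qp_neq0 N rQ, qp_neq0 l rU, qp_neq0 l.+1 rU,
  qp_neq0 (N + l).+1 rU, rU 0); rewrite expr0 mulr1.
move: (qp _ Q _) (qp _ Q _) (qp _ Q _) (qp _ U _) (qp _ U _) (qp _ U _).
move: (c ^+ l) => cl x1 x2 x3 x4 x5 x6 [] [] [] [] [] ? ? ? ? ? ?.
by field; rewrite ?oner_eq0 /=; do ?[apply/andP; split].
Qed.

(** At m = 0 only k = 0 occurs and z^* R_(0,l) = R_(0,l+1) has no lower term, so the step is the
    q-Pascal rule; its factor Q^l comes from moving z^* past s^l in both slots. *)
Lemma addition_step_base n l :
  zadd_coef q U 0 n 0 l * b (zmulV zs (zadd_fun U 0 n 0 l v))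
                            (zmulV zs (zadd_fun U 0 n 0 l v'))
  + (if l is l'.+1 then
       c * zadd_coef q U 0 n 0 l' * b (smul (zadd_fun U 0 n 0 l' v))
                                      (smul (zadd_fun U 0 n 0 l' v')) else 0)
  = aterm 0 n.+1 0 l.
Proof.
have E1 (w : V) : (l <= n)%N -> zmulV zs (zadd_fun U 0 n 0 l w)
    = c ^+ l *: zadd_fun U 0 n.+1 0 l w.
  move=> ln; rewrite /zadd_fun zmulV_star_fop // mul_zs_zdisk // up_coef_star0 //.
  by rewrite down_coef_star0 scale0r addr0 scale1r subSn.
have E2 l' (w : V) : smul (zadd_fun U 0 n 0 l' w) = zadd_fun U 0 n.+1 0 l'.+1 w.
  rewrite /zadd_fun !add0n subSS (zdisk_shift0 q_gt0).
  have -> : T * Q ^+ l' * Q = T * Q ^+ l'.+1 by rewrite (exprSr Q) mulrA.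
  by [].
rewrite /addition_term; have [ln|nl] := leqP l n; last first.
  rewrite zadd_coef_eq0 ?mul0r ?add0r; last by rewrite -ltnNge nl.
  have [l' ll'] : exists l', l = l'.+1 by case: (l) nl => // l' _; exists l'.
  rewrite {l}ll' ltnS leq_eqVlt in nl {E1} *.
  have [nl'|nl'] := eqVneq n l'.
    rewrite !E2 nl'; congr (_ * _); rewrite /zadd_coef !leqnn /= !subnn.
    rewrite !addition_coef00 !add0n qp0 !mulr1 (exprS c) !divff ?mulr1 //;
      exact: qp_neq0.
  move: nl; rewrite (negPf nl') /= => nl.
  rewrite -/(addition_term U b v v' 0 n.+1 0 l'.+1).
  rewrite addition_term0; last by rewrite -ltnNge ltnS nl.
  rewrite zadd_coef_eq0; last by rewrite -ltnNge nl.
  have h (x : C) : c * 0 * x = 0 by rewrite mulr0 mul0r.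
  exact: h.
rewrite !E1 // (bilinear_scale Hb) mulrA.
case: l ln {E1} => [|l] ln; rewrite ?E2.
  rewrite addr0 expr0 expr1n mulr1 /zadd_coef !leq0n /= !subn0.
  by rewrite !addition_coef0.
rewrite -mulrDl; congr (_ * _).
rewrite /zadd_coef ln (ltnW ln) ltnS (ltnW ln) /= subSS.
have -> : (c ^+ l.+1) ^+ 2 = Q ^+ l.+1 by rewrite -exprM mulnC exprM expr2 -QcE.
rewrite -(subnSK ln).
rewrite !addition_coef00; move: (n - l.+1)%N => N {ln}.
rewrite !addSn !addnS !qpS -!(exprS Q) (exprS c).
have := (subQS_neq0 rQ N, subQS_neq0 rQ l, qp_neq0 l rQ, qp_neq0 N rQ).
move: (qp _ _ _) (qp _ _ _) (qp _ _ _) => w1 w2 w3.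
rewrite !(exprS Q) !(exprD Q).
move: (Q ^+ l) (Q ^+ N) (c ^+ l) Qn0 => ql qn cl.
move: c (q ^+ 2)%:C => d p Q0 [] [] [] ? ? ? ?.
by field; do ?[apply/andP; split].
Qed.

End InductionStep.

Local Notation E := (V -> V -> A -> C^o).

(* The transposes of left multiplication by Phi(z) and Phi(z^* ), where
   Phi(z) = z (x) z (x) 1 + q s (x) s (x) z. *)
Definition phi_gen (b : E) : E := fun v v' x =>
  b (zmulV z v) (zmulV z v') x + c * b (smul v) (smul v') (z * x).

Definition phi_gen_star (b : E) : E := fun v v' x =>
  b (zmulV zs v) (zmulV zs v') x + c * b (smul v) (smul v') (zs * x).

Definition trilinear_form (b : E) :=
  (forall x, bilinear_form (fun v v' => b v v' x)) /\
  (forall a v v' x y, b v v' (a *: x + y) = a * b v v' x + b v v' y).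

Lemma zmulV_linear (x : A) a (u v : V) :
  zmulV x (a *: u + v) = a *: zmulV x u + zmulV x v.
Proof. by rewrite zmulVDr zmulVZr. Qed.

Lemma smul_linear a (u v : V) : smul (a *: u + v) = a *: smul u + smul v.
Proof. by rewrite smulD // smulZ. Qed.

Lemma trilinear_pull (b : E) (f : V -> V) (x : A) :
  (forall a u v, f (a *: u + v) = a *: f u + f v) -> trilinear_form b ->
  trilinear_form (fun v v' y => b (f v) (f v') (x * y)).
Proof.
move=> hf [h1 h2]; split=> [y|a v v' y y'].
  by split=> a u v w; rewrite hf; [exact: (h1 _).1|exact: (h1 _).2].
by rewrite mulrDr -scalerAr h2.
Qed.

Lemma trilinear_comb (a : C) (b b' : E) : trilinear_form b -> trilinear_form b' ->
  trilinear_form (fun v v' x => a * b v v' x + b' v v' x).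
Proof.
move=> [h1 h2] [h1' h2']; split=> [y|d v v' y y'].
  split=> d u v w; have [e1 e2] := h1 y; have [e1' e2'] := h1' y.
    by rewrite e1 e1'; ring.
  by rewrite e2 e2'; ring.
by rewrite h2 h2'; ring.
Qed.

(** The mixed terms agree by s z = q z s and s z^* = q^-1 z^* s. The others are polynomials in x,
    z^* z = 1 - Q x and z z^* = 1 - x, and expanding them requires [b] to be trilinear. *)
Lemma phi_relation (b : E) : trilinear_form b ->
  phi_gen (phi_gen_star b) = Q *: phi_gen_star (phi_gen b) + (1 - Q) *: b.
Proof.
move=> [h1 h2]; apply/funext => v; apply/funext => v'; apply/funext => x.
rewrite !fctE -![_ *: _ : C^o]/(_ * _) /phi_gen /phi_gen_star.
rewrite !smul_z // !smul_zs // !smul_smul // !zmulVA !mulrA zs_zE z_zs.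
rewrite !(bilinear_scale (h1 _)).
have e1 (w : V) : zmulV (1 - Q *: zx q) w = 1 *: w + (- Q) *: zmulV (zx q) w.
  by case: w => a d; rewrite scale1r scaleNr -zmulVZl /zmulV !mulrBl !mul1r.
have e2 (w : V) : zmulV (1 - zx q) w = 1 *: w + (- 1) *: zmulV (zx q) w.
  by case: w => a d; rewrite scale1r scaleN1r /zmulV !mulrBl !mul1r.
have e3 : (1 - Q *: zx q) * x = (- Q) *: (zx q * x) + x.
  by rewrite mulrBl mul1r -scalerAl scaleNr addrC.
have e4 : (1 - zx q) * x = (- 1) *: (zx q * x) + x.
  by rewrite mulrBl mul1r scaleN1r addrC.
rewrite !e1 !e2 !(bilinear_comb (h1 _)) e3 e4 !h2.
have := @QcE _ q; have := cn0; move: (q ^+ 2)%:C (q%:C : C) => p d d0 pd.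
set b1 := b v v' x; set b2 := b v _ x; set b3 := b _ v' x; set b4 := b _ _ x.
set b5 := b _ _ (zs * x); set b6 := b _ _ (z * x); set b7 := b _ _ (zx q * x).
move: b1 b2 b3 b4 b5 b6 b7 => b1 b2 b3 b4 b5 b6 b7; rewrite pd.
by field.
Qed.

Lemma phi_module : right_zmodule q phi_gen phi_gen_star trilinear_form.
Proof.
split.
- move=> a u w; apply/funext => v; apply/funext => v'; apply/funext => x.
  rewrite /phi_gen !fctE -![_ *: _ : C^o]/(_ * _).
  by ring.
- move=> a u w; apply/funext => v; apply/funext => v'; apply/funext => x.
  rewrite /phi_gen_star !fctE -![_ *: _ : C^o]/(_ * _).
  by ring.
- by move=> a u w hu hw; exact: trilinear_comb.
- move=> b hb; have -> : phi_gen b = fun v v' x =>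
      c * b (smul v) (smul v') (z * x) + b (zmulV z v) (zmulV z v') (1 * x).
    apply/funext => v; apply/funext => v'; apply/funext => x.
    by rewrite mul1r addrC.
  apply: trilinear_comb; first exact: trilinear_pull smul_linear hb.
  exact: trilinear_pull (zmulV_linear z) hb.
- move=> b hb; have -> : phi_gen_star b = fun v v' x =>
      c * b (smul v) (smul v') (zs * x) + b (zmulV zs v) (zmulV zs v') (1 * x).
    apply/funext => v; apply/funext => v'; apply/funext => x.
    by rewrite mul1r addrC.
  apply: trilinear_comb; first exact: trilinear_pull smul_linear hb.
  exact: trilinear_pull (zmulV_linear zs) hb.
- exact: phi_relation.
Qed.

Lemma zcoef_term0 m n k l (x : C) :
  ~~ ((k <= m)%N && (l <= n)%N) -> zadd_coef q U m n k l * x = 0.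
Proof. by move=> h; rewrite zadd_coef_eq0 // mul0r. Qed.

Lemma sum_shift (K : nat) (f : nat -> C) : f K = 0 ->
  \sum_(k < K.+1) f k = \sum_(k < K.+1) (if (k : nat) is k'.+1 then f k' else 0).
Proof. by move=> fK; rewrite big_ord_recr /= fK addr0 big_ord_recl /= add0r. Qed.

Lemma sum_unshift (L : nat) (f : nat -> C) : f 0%N = 0 -> f L.+1 = 0 ->
  \sum_(l < L.+1) f l = \sum_(l < L.+1) f l.+1.
Proof. by move=> f0 fL; rewrite big_ord_recl f0 add0r big_ord_recr /= fL addr0. Qed.

(** The box stays fixed while m and n vary in the induction. *)
Definition addition_sum (K L m n : nat) (b : E) (v v' : V) (x : A) : C :=
  \sum_(k < K) \sum_(l < L)
    zadd_coef q U m n k l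
      * b (zadd_fun U m n k l v) (zadd_fun U m n k l v') (zdisk q U k l * x).

Lemma addition_sum_step K L m n b v v' x : trilinear_form b ->
  (m < K)%N -> (n <= L)%N ->
  addition_sum K.+1 L.+1 m n (phi_gen b) v v' x =
  up_coef q T m n * addition_sum K.+1 L.+1 m.+1 n b v v' x
  + down_coef q T m n * addition_sum K.+1 L.+1 m n.-1 b v v' x.
Proof.
move=> [h1 h2] mK nL.
have h20 u u' : b u u' 0 = 0.
  by have := h2 (-1) u u' 0 0; rewrite scaleN1r oppr0 addr0 mulN1r addNr.
have h3 u u' a d y y' : b u u' (a *: y + d *: y') = a * b u u' y + d * b u u' y'.
  by rewrite h2 -[d *: y']addr0 h2 h20 addr0.
pose bb k l := fun u u' => b u u' (zdisk q U k l * x).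
(* X stays at R_(k,l), Y is carried to R_(k+1,l) and Z to R_(k,l-1). Reindexing Y and Z collects
   everything at (k,l); the boundary terms vanish. *)
pose X k l := step_z_term U (bb k l) v v' m n k l.
pose Y k l := step_s_term U (bb k.+1 l) v v' m n k l (up_coef q U k l).
pose Z k l := step_s_term U (bb k l.-1) v v' m n k l (down_coef q U k l).
have -> : addition_sum K.+1 L.+1 m n (phi_gen b) v v' x =
    \sum_(k < K.+1) \sum_(l < L.+1) (X k l + Y k l + Z k l).
  apply: eq_bigr => k _; apply: eq_bigr => l _.
  rewrite /phi_gen mulrA mul_z_zdisk // mulrDl -!scalerAl h3.
  rewrite /X /Y /Z /step_z_term /step_s_term /bb.
  move: (zadd_coef _ _ _ _ _ _) (b _ _ _) (b _ _ _) (b _ _ _) c => e b1 b2 b3 d.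
  by ring.
have -> : \sum_(k < K.+1) \sum_(l < L.+1) (X k l + Y k l + Z k l) =
    \sum_(k < K.+1) \sum_(l < L.+1) (X k l
      + (if (k : nat) is k'.+1 then Y k' l else 0) + Z k l.+1).
  under eq_bigr do rewrite !big_split /=; rewrite !big_split /=.
  under [RHS]eq_bigr do rewrite !big_split /=; rewrite !big_split /=.
  congr (_ + _ + _).
    rewrite (sum_shift (f := fun k => \sum_(l < L.+1) Y k l)).
      by apply: eq_bigr => -[[|k] hk] _ //=; rewrite big1.
    by rewrite big1 // => l _; apply: step_s_term0; rewrite negb_and -ltnNge mK.
  apply: eq_bigr => k _; apply: sum_unshift.
    by rewrite /Z /step_s_term down_coef0 mulr0 mulr0 mul0r.
  by apply: step_s_term0; rewrite negb_and -!ltnNge ltnS nL orbT.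
rewrite /addition_sum !mulr_sumr -big_split /=; apply: eq_bigr => k _.
rewrite !mulr_sumr -big_split /=; apply: eq_bigr => l _.
rewrite -(addition_step_all (h1 _)) //; congr (_ + _ + _).
by case: (k : nat).
Qed.

Lemma addition_sum_base K L n b v v' x : trilinear_form b -> (n <= L)%N ->
  addition_sum K.+1 L.+2 0 n (phi_gen_star b) v v' x =
  addition_sum K.+1 L.+2 0 n.+1 b v v' x.
Proof.
move=> [h1 h2] nL; rewrite /addition_sum.
rewrite [LHS]big_ord_recl [RHS]big_ord_recl /=.
rewrite [X in _ + X = _]big1; last first.
  by move=> k _; rewrite big1 // => l _; exact: zcoef_term0.
rewrite [X in _ = _ + X]big1; last first.
  by move=> k _; rewrite big1 // => l _; exact: zcoef_term0.
rewrite !addr0.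
pose X l := zadd_coef q U 0 n 0 l * b (zmulV zs (zadd_fun U 0 n 0 l v))
  (zmulV zs (zadd_fun U 0 n 0 l v')) (zdisk q U 0 l * x).
pose Y l := c * zadd_coef q U 0 n 0 l * b (smul (zadd_fun U 0 n 0 l v))
  (smul (zadd_fun U 0 n 0 l v')) (zdisk q U 0 l.+1 * x).
transitivity (\sum_(l < L.+2) (X l + Y l)).
  apply: eq_bigr => l _; rewrite /phi_gen_star mulrA mul_zs_zdisk //.
  rewrite up_coef_star0 // down_coef_star0 scale0r addr0 scale1r /X /Y.
  move: (zadd_coef _ _ _ _ _ _) (b _ _ _) (b _ _ _) c => e b1 b2 d.
  by ring.
rewrite big_split /= (sum_shift (f := Y)); last first.
  rewrite /Y zadd_coef_eq0; last by rewrite negb_and -!ltnNge ltnS nL orbT.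
  have h (y : C) : c * 0 * y = 0 by rewrite mulr0 mul0r.
  exact: h.
rewrite -big_split /=; apply: eq_bigr => -[l hl] _ /=.
have := addition_step_base (h1 (zdisk q U 0 l * x)) v v' n l.
rewrite /addition_term => <-; congr (_ + _).
by case: l {hl}.
Qed.

Lemma addition_formula K L m n b v v' x : trilinear_form b ->
  (m <= K)%N -> (n <= L)%N ->
  zact phi_gen phi_gen_star (zdisk q T m n) b v v' x
  = addition_sum K.+1 L.+1 m n b v v' x.
Proof.
(* The form [b] must be generalized: the generator in front acts first and replaces it by another
   trilinear form. *)
move=> hb; elim: m n b hb v v' x => [|m IH] n b hb v v' x mK nL.
  elim: n b hb v v' x nL => [|n IH] b hb v v' x nL.
    rewrite zdisk00 // (zact1 phi_module) // /addition_sum.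
    rewrite !big_ord_recl [X in _ + X]big1; last first.
      by move=> k _; rewrite big1 // => l _; exact: zcoef_term0.
    rewrite big1; last by move=> l _; exact: zcoef_term0.
    rewrite !addr0 /zadd_coef /= addition_coef0 // mul1r zdisk00 // mul1r.
    have h (w : V) : zadd_fun U 0 0 0 0 w = w.
      by rewrite /zadd_fun /= zdisk00 // /fop /= zmul1V.
    by rewrite !h.
  have -> : zdisk q T 0 n.+1 = zs * zdisk q T 0 n.
    by rewrite mul_zs_zdisk // up_coef_star0 // down_coef_star0 scale0r addr0 scale1r.
  rewrite (zactM phi_module) // (zact_gen_star phi_module) // IH; first last.
  - exact: ltnW.
  - exact: (rzm_g_closed phi_module).
  by case: (L) nL => // L' nL; rewrite addition_sum_base.
apply: (mulfI (up_coef_neq0 rT0 m n)).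
transitivity (zact phi_gen phi_gen_star (up_coef q T m n *: zdisk q T m.+1 n) b v v' x).
  by rewrite (zactZ phi_module) // !fctE.
have -> : up_coef q T m n *: zdisk q T m.+1 n
    = z * zdisk q T m n - down_coef q T m n *: zdisk q T m n.-1.
  by rewrite mul_z_zdisk // addrK.
rewrite (zactB phi_module) // (zactM phi_module) // (zactZ phi_module) //.
rewrite (zact_gen phi_module) // !fctE -![_ *: _ : C^o]/(_ * _).
rewrite !IH ?(ltnW mK) ?(leq_trans (leq_pred n)) //; last first.
  exact: (rzm_f_closed phi_module).
by rewrite addition_sum_step // addrK.
Qed.

End AdditionFormula.

(** * Positivity *)

Section Positivity.
Context (R : realType) (q : R).
Local Notation C := R[i].
Local Notation Q := ((q ^+ 2)%:C : C).
Local Notation c := (q%:C : C).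
Local Notation A := (zalg q).
Local Notation V := (A * A)%type.
Local Notation z := (zgen q).
Local Notation zs := (zgen_star q).

Hypothesis q_gt0 : 0 < q.
Hypothesis q_lt1 : q < 1.

(** The real subalgebra generated by z and z^*. Its elements have real coefficients eps_w, without
    which squares need not be nonnegative in C. *)
Inductive zreal : A -> Prop :=
  | zreal_const a : a \is Num.real -> zreal (a *: 1)
  | zreal_z : zreal z
  | zreal_zs : zreal zs
  | zreal_add x y : zreal x -> zreal y -> zreal (x + y)
  | zreal_mul x y : zreal x -> zreal y -> zreal (x * y).

Let Qr : Q \is Num.real.
Proof. by rewrite ger0_real // ltW // Q_gt0. Qed.

Let cr : c \is Num.real.
Proof. by rewrite ger0_real // ler0c ltW. Qed.

Lemma zreal1 : zreal 1.
Proof. by rewrite -[1]scale1r; apply: zreal_const; exact: rpred1. Qed.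

Lemma zrealZ a x : a \is Num.real -> zreal x -> zreal (a *: x).
Proof.
by move=> ra rx; rewrite -[x]mul1r scalerAl; apply: zreal_mul => //;
  exact: zreal_const.
Qed.

Lemma zrealX x n : zreal x -> zreal (x ^+ n).
Proof.
move=> rx; elim: n => [|n IH]; first by rewrite expr0; exact: zreal1.
by rewrite exprS; exact: zreal_mul.
Qed.

Lemma zreal_zx : zreal (zx q).
Proof.
rewrite zxE -scaleN1r; apply: zreal_add; first exact: zreal1.
apply: zrealZ; first by rewrite rpredN rpred1.
by apply: zreal_mul; [exact: zreal_z|exact: zreal_zs].
Qed.

Lemma zev_poly n (a : nat -> C) :
  zev q (\poly_(k < n) a k) = \sum_(k < n) a k *: zx q ^+ k.
Proof.
rewrite poly_def (big_morph (zev q) (@zevD _ q) (rmorph0 _)).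
by apply: eq_bigr => k _; rewrite zevZ /zev rmorphXn /= horner_algX.
Qed.

Lemma zreal_zev n (a : nat -> C) : (forall k, a k \is Num.real) ->
  zreal (zev q (\poly_(k < n) a k)).
Proof.
move=> ra; rewrite zev_poly; apply: big_ind => [| |k _].
- by rewrite -(scale0r 1); apply: zreal_const; exact: rpred0.
- exact: zreal_add.
- by apply: zrealZ => //; apply/zrealX/zreal_zx.
Qed.

Lemma qp_real (T : C) k : T \is Num.real -> qp Q T k \is Num.real.
Proof.
by move=> rT; apply: rpred_prod => j _; rewrite rpredB ?rpred1 ?rpredM ?rpredX.
Qed.

Lemma zreal_zdisk T m n : T \is Num.real -> zreal (zdisk q T m n).
Proof.
move=> rT.
have h a b k : jacobi_coef Q T a b k \is Num.real.
  by rewrite /jacobi_coef !(rpredM, rpredV, rpredX, qp_real).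
rewrite /zdisk; case: leqP => _; apply: zreal_mul.
- exact/zrealX/zreal_z.
- exact: zreal_zev.
- exact: zreal_zev.
- exact/zrealX/zreal_zs.
Qed.

Lemma zreal_sigma x : zreal x -> zreal (sigma x).
Proof.
elim=> [a ra|||u v _ hu _ hv|u v _ hu _ hv].
- by rewrite sigmaZ // sigma1 //; exact: zreal_const.
- by rewrite sigma_z //; apply: zrealZ => //; exact: zreal_z.
- by rewrite sigma_zs //; apply: zrealZ; [rewrite rpredV|exact: zreal_zs].
- by rewrite sigmaD //; exact: zreal_add.
- by rewrite sigmaM //; exact: zreal_mul.
Qed.

Definition vreal (v : V) := zreal v.1 /\ zreal v.2.

Lemma vreal_fop j u v : zreal u -> vreal v -> vreal (fop j u v).
Proof.
move=> ru [r1 r2]; rewrite /fop; elim: j => [|j [h1 h2]] /=.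
  by split; apply: zreal_mul.
split=> /=; last exact: zreal_sigma.
by apply: zreal_mul; [exact: zreal_sigma|exact: zreal_zx].
Qed.

Local Ltac real_closed := repeat first [assumption | exact: rpred1 | apply: rpredB
  | apply: rpredD | apply: rpredM | apply: rpredX | rewrite rpredV].

Lemma up_coef_real T m n : T \is Num.real ->
  up_coef q T m n \is Num.real /\ down_coef q T m n \is Num.real.
Proof.
by move=> rT; have Qr' := Qr; rewrite /up_coef /down_coef; split; real_closed.
Qed.

Lemma up_coef_star_real T m n : T \is Num.real ->
  up_coef_star q T m n \is Num.real /\ down_coef_star q T m n \is Num.real.
Proof.
move=> rT; have Qr' := Qr; rewrite /up_coef_star /down_coef_star.
by split; real_closed.
Qed.

Lemma zact_real T x (g : nat * nat -> C^o) : T \is Num.real -> regular Q T ->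
  zreal x -> (forall y, (g y : C) \is Num.real) ->
  forall y, (zact (coef_gen q T) (coef_gen_star q T) x g y : C) \is Num.real.
Proof.
move=> rT regT rx; have cm := coef_module regT.
elim: rx g => [a ra|||u v _ hu _ hv|u v _ hu _ hv] g rg y.
- by rewrite (zactZ cm) // (zact1 cm) // fctE -[_ *: _ : C^o]/(_ * _) rpredM.
- have [h1 h2] := up_coef_real y.1 y.2 rT.
  by rewrite (zact_gen cm) //; apply: rpredD; apply: rpredM.
- have [h1 h2] := up_coef_star_real y.1 y.2 rT.
  by rewrite (zact_gen_star cm) //; apply: rpredD; apply: rpredM.
- by rewrite (zactD cm) // fctE rpredD ?hu ?hv.
- by rewrite (zactM cm) //; apply: hv => y'; exact: hu.
Qed.

Lemma zcoef_real T w x : T \is Num.real -> regular Q T -> zreal x ->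
  zcoef T w x \is Num.real.
Proof.
move=> rT regT rx; apply: zact_real => // y.
by rewrite /dual_basis; case: eqP; rewrite ?rpred1 ?rpred0.
Qed.

Context (U : C).
Hypothesis U_gt0 : 0 < U.
Hypothesis U_lt1 : U < 1.
Local Notation T := (U * Q).

Let rU : regular Q U.
Proof. by apply: regular_lt1 => //; exact: ltW. Qed.

Let T_gt0 : 0 < T. Proof. by rewrite mulr_gt0 // Q_gt0. Qed.
Let T_lt1 : T < 1.
Proof.
by rewrite (lt_trans _ U_lt1) // gtr_pMr // Q_lt1.
Qed.
Let rT : regular Q T.
Proof. by apply: regular_lt1 => //; exact: ltW. Qed.

Lemma one_sub_gt0 (S : C) k : 0 < S -> S < 1 -> 0 < 1 - S * Q ^+ k.
Proof.
move=> S0 S1; rewrite subr_gt0; apply: le_lt_trans S1.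
rewrite ler_piMr //; first exact: ltW.
by apply: exprn_ile1; apply: ltW; [exact: Q_gt0|exact: Q_lt1].
Qed.

Lemma qp_gt0 (S : C) k : 0 < S -> S < 1 -> 0 < qp Q S k.
Proof. by move=> S0 S1; apply: prodr_gt0 => j _; exact: one_sub_gt0. Qed.

Local Ltac positivity := repeat first [assumption | apply: mulr_gt0
  | apply: exprn_gt0 | rewrite invr_gt0].

(** All factors 1 - U Q^j are positive because U < 1, which for U = q^(2 alpha) is the condition
    alpha > 0. *)
Lemma zadd_coef_ge0 m n k l : 0 <= zadd_coef q U m n k l.
Proof.
rewrite /zadd_coef; case: ifP => // _; rewrite /addition_coef ltW //.
have wp j : 0 < qp Q Q j by rewrite qp_gt0 ?Q_gt0 ?Q_lt1.
have up j : 0 < qp Q U j by rewrite qp_gt0.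
have Q0 : 0 < Q by exact: Q_gt0.
have c0 : 0 < c by rewrite ltcR.
have U1 : 0 < 1 - U by rewrite subr_gt0.
by positivity; first [exact: wp|exact: up].
Qed.

Lemma weight_gt0 (S : C) m n : 0 < S -> S < 1 -> 0 < weight q S m n.
Proof.
move=> S0 S1; rewrite /weight.
have wp j : 0 < qp Q Q j by rewrite qp_gt0 ?Q_gt0 ?Q_lt1.
have up j : 0 < qp Q S j by rewrite qp_gt0.
have s1 : 0 < 1 - S by rewrite subr_gt0.
have s2 := one_sub_gt0 (m + n) S0 S1.
by positivity; first [exact: wp|exact: up].
Qed.

(** The functional eps_w (x) eps_w (x) h, with eps_w extended by 0 to Z s. *)
Definition square_form (w : nat * nat) : V -> V -> A -> C^o := fun v v' x =>
  zcoef T w v.1 * zcoef T w v'.1 * zcoef U (0%N, 0%N) x.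

Lemma square_form_trilinear w : trilinear_form (square_form w).
Proof.
split=> [x|a v v' x y]; last first.
  by rewrite /square_form (zcoefD rU) (zcoefZ rU); ring.
by split=> a u v v'; rewrite /square_form /= (zcoefD rT) (zcoefZ rT); ring.
Qed.

Local Notation phi := (zact (@phi_gen _ q) (@phi_gen_star _ q)).
Local Notation e := ((1, 0) : V).

(** For u = R_(m,n), h kills every term of the addition formula except k = l = 0, where the
    coefficient is 1. General u follows by linearity. *)
Lemma phi_square w (u : A) : phi u (square_form w) e e 1 = zcoef T w u.
Proof.
have pm := phi_module q_gt0; have tri := square_form_trilinear w.
have hR m n : phi (zdisk q T m n) (square_form w) e e 1 = ((m, n) == w)%:R.
  rewrite (@addition_formula _ _ _ q_gt0 q_lt1 rU m n) // /addition_sum.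
  rewrite big_ord_recl [X in _ + X]big1 ?addr0; last first.
    move=> k _; rewrite big1 // => l _; rewrite /square_form mulr1.
    by rewrite (zcoef_zdisk q_gt0 q_lt1 rU) xpair_eqE /= !mulr0.
  rewrite big_ord_recl [X in _ + X]big1 ?addr0; last first.
    move=> l _; rewrite /square_form mulr1.
    by rewrite (zcoef_zdisk q_gt0 q_lt1 rU) xpair_eqE /= !mulr0.
  have ac : addition_coef Q c U m 0 n 0 = 1.
    by apply: addition_coef0 => //; exact: regular_Q.
  rewrite /zadd_coef /= !subn0 ac mul1r.
  rewrite /square_form mulr1 (zcoef_zdisk q_gt0 q_lt1 rU) eqxx mulr1.
  rewrite /zadd_fun /fop /= !subn0 !addn0 expr0 !mulr1.
  rewrite (zcoef_zdisk q_gt0 q_lt1 rT).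
  (* The value is eps_w(R_(m,n))^2, which is eps_w(R_(m,n)) since that number is 0 or 1. *)
  by case: eqP; rewrite ?mulr1 ?mulr0.
have [s ->] := zspan_all q_gt0 q_lt1 rT u.
rewrite (zact_sum pm) // (zcoef_sum rT) !fct_sumE.
apply: eq_bigr => p _; rewrite (zactZ pm) // (zcoefZ rT) !fctE.
by rewrite (zcoef_zdisk q_gt0 q_lt1 rT) hR -surjective_pairing.
Qed.

Lemma zcoef_mul_ge0 (x y w : nat * nat) :
  0 <= zcoef T w (zdisk q T x.1 x.2 * zdisk q T y.1 y.2).
Proof.
have pm := phi_module q_gt0; have tri := square_form_trilinear w.
rewrite -phi_square (zactM pm) //.
(* R_x acts first, so the outer expansion is that of R_y, applied to a form already transformed by
   R_x. *)
rewrite (@addition_formula _ _ _ q_gt0 q_lt1 rU y.1 y.2) //; last first.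
  exact: (zact_closed pm).
rewrite /addition_sum; apply: sumr_ge0 => k' _; apply: sumr_ge0 => l' _.
rewrite mulr_ge0 ?zadd_coef_ge0 //.
rewrite (@addition_formula _ _ _ q_gt0 q_lt1 rU x.1 x.2) //.
rewrite /addition_sum; apply: sumr_ge0 => k _; apply: sumr_ge0 => l _.
rewrite mulr_ge0 ?zadd_coef_ge0 // /square_form mulr1.
have Tr j : T * Q ^+ j \is Num.real by rewrite rpredM ?rpredX // gtr0_real.
rewrite mulr_ge0 //; last first.
  rewrite (@zcoef_zdiskM _ _ _ q_gt0 q_lt1 rU (k : nat, l : nat) (k' : nat, l' : nat)).
  by rewrite mulr_ge0 ?ler0n // ltW // weight_gt0.
(* Both slots hold the same vector f_(k,l) f_(k',l'), whence a square; the third slot was a squared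
   norm or 0. *)
rewrite -expr2 real_exprn_even_ge0 //; apply: zcoef_real => //.
  by rewrite gtr0_real.
have [] // : vreal (zadd_fun U x.1 x.2 k l (zadd_fun U y.1 y.2 k' l' e)).
apply: vreal_fop; first exact: zreal_zdisk.
apply: vreal_fop; first exact: zreal_zdisk.
split; first exact: zreal1.
by rewrite /= -(scale0r 1); apply: zreal_const; exact: rpred0.
Qed.

End Positivity.

(** * Linearization coefficients *)

Section Linearization.
Context (R : realType) (q : R).
Local Notation C := R[i].
Local Notation Q := ((q ^+ 2)%:C : C).
Local Notation A := (zalg q).
Local Notation z := (zgen q).
Local Notation zs := (zgen_star q).

Hypothesis q_gt0 : 0 < q.
Hypothesis q_lt1 : q < 1.

Definition zchar (x : A) : C := zeval1 (repr x).

Lemma zchar_class t : zchar (zclass q t) = zeval1 t.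
Proof. exact: zeval1_cong (repr_zclass _ _). Qed.

Lemma zcharD x y : zchar (x + y) = zchar x + zchar y.
Proof. by rewrite [x + y]/(zadd x y) zchar_class. Qed.

Lemma zcharM x y : zchar (x * y) = zchar x * zchar y.
Proof. by rewrite [x * y]/(zmul x y) zchar_class. Qed.

Lemma zcharZ a x : zchar (a *: x) = a * zchar x.
Proof.
by rewrite [a *: x]/(zmul (zclass q (ZConst a)) x) zcharM zchar_class.
Qed.

Lemma zchar1 : zchar 1 = 1. Proof. exact: zchar_class. Qed.
Lemma zchar_z : zchar z = 1. Proof. exact: zchar_class. Qed.
Lemma zchar_zs : zchar zs = 1. Proof. exact: zchar_class. Qed.

Lemma zchar0 : zchar 0 = 0.
Proof. by rewrite -(scale0r 0) zcharZ mul0r. Qed.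

Lemma zcharX x n : zchar x = 1 -> zchar (x ^+ n) = 1.
Proof.
move=> h; elim: n => [|n IH]; first by rewrite expr0 zchar1.
by rewrite exprS zcharM h IH mulr1.
Qed.

Lemma zchar_zev p : zchar (zev q p) = p`_0.
Proof.
have zx0 : zchar (zx q) = 0.
  rewrite zxE -scaleN1r zcharD zcharZ zcharM zchar_z zchar_zs zchar1 mulr1.
  by rewrite mulN1r subrr.
elim/poly_ind: p => [|p a _]; first by rewrite /zev rmorph0 zchar0 coef0.
rewrite !(zevD, zevM, zevX, zevC) zcharD zcharM zx0 mulr0 add0r zcharZ zchar1.
by rewrite coefD coefMX coefC /= add0r mulr1.
Qed.

(** The character sends x = 1 - z z^* to 0, and little q-Jacobi polynomials are 1 at 0. *)
Lemma zchar_zdisk T m n : zchar (zdisk q T m n) = 1.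
Proof.
have h a b : zchar (zev q (jacobi Q T a b)) = 1.
  rewrite zchar_zev coef_jacobi; last exact: Q_neq0.
  by rewrite /jacobi_coef !qp0 expr0 !mulr1 invr1 mulr1.
rewrite /zdisk; case: leqP => _; rewrite zcharM h ?mulr1 ?mul1r;
  by apply: zcharX; rewrite ?zchar_z ?zchar_zs.
Qed.

Section Coefs.
Context (T : C).
Hypothesis rT : regular Q T.

Local Notation D x := (zdisk q T x.1 x.2).

Definition lin_coef (x y w : nat * nat) : C := zcoef T w (D x * D y).

Local Notation cD := (zcoefD rT).
Local Notation cZ := (zcoefZ rT).
Local Notation cS := (zcoef_sum rT).

Lemma zcoefE w x : zcoef T w (D x) = (x == w)%:R.
Proof. by case: x => m n; exact: (zcoef_zdisk q_gt0 q_lt1 rT). Qed.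

Lemma lin_coef_support x y : exists2 s : seq (nat * nat), uniq s &
  (forall w, w \notin s -> lin_coef x y w = 0) /\
  D x * D y = \sum_(w <- s) lin_coef x y w *: D w.
Proof. exact: (zdisk_expansion q_gt0 q_lt1 rT). Qed.

Lemma sum_lin_coef x y (s : seq (nat * nat)) : uniq s ->
  (forall w, w \notin s -> lin_coef x y w = 0) ->
  D x * D y = \sum_(w <- s) lin_coef x y w *: D w.
Proof.
move=> us hs; have [s' us' [hs' ->]] := lin_coef_support x y.
rewrite (bigID (mem s)) /= [X in _ + X]big1 ?addr0; last first.
  by move=> w ws; rewrite hs // scale0r.
rewrite [RHS](bigID (mem s')) /= [X in _ = _ + X]big1 ?addr0; last first.
  by move=> w ws; rewrite hs' // scale0r.
rewrite -big_filter -[RHS]big_filter; apply: perm_big; apply: uniq_perm;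
  rewrite ?filter_uniq //.
by move=> w; rewrite !mem_filter andbC.
Qed.

Lemma lin_coef_sum1 x y (s : seq (nat * nat)) : uniq s ->
  (forall w, w \notin s -> lin_coef x y w = 0) ->
  \sum_(w <- s) lin_coef x y w = 1.
Proof.
move=> us hs; have := congr1 zchar (sum_lin_coef us hs).
rewrite zcharM !zchar_zdisk mulr1 (big_morph zchar zcharD zchar0) => ->.
by apply: eq_bigr => w _; rewrite zcharZ zchar_zdisk mulr1.
Qed.

Lemma lin_coef_assoc x y w u (s s' : seq (nat * nat)) : uniq s -> uniq s' ->
  (forall v, v \notin s -> lin_coef y w v = 0) ->
  (forall v, v \notin s' -> lin_coef x y v = 0) ->
  \sum_(v <- s) lin_coef y w v * lin_coef x v u =
  \sum_(v <- s') lin_coef x y v * lin_coef v w u.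
Proof.
move=> us us' hs hs'; transitivity (zcoef T u (D x * (D y * D w))).
  rewrite (sum_lin_coef us hs) mulr_sumr cS.
  by apply: eq_bigr => v _; rewrite -scalerAr cZ.
rewrite mulrA (sum_lin_coef us' hs') mulr_suml cS.
by apply: eq_bigr => v _; rewrite -scalerAl cZ.
Qed.

Lemma lin_coef_inv x y w :
  lin_coef (y.2, y.1) (x.2, x.1) (w.2, w.1) = lin_coef x y w.
Proof.
by rewrite /lin_coef -(zcoef_zdag q_gt0 q_lt1 rT) zdagM !zdag_zdisk.
Qed.

Lemma lin_coef_unitl y w : lin_coef (0%N, 0%N) y w = (y == w)%:R.
Proof. by rewrite /lin_coef zdisk00 // mul1r zcoefE. Qed.

Lemma lin_coef_unitr y w : lin_coef y (0%N, 0%N) w = (y == w)%:R.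
Proof. by rewrite /lin_coef zdisk00 // mulr1 zcoefE. Qed.

Lemma lin_coef_unit x y :
  lin_coef (x.2, x.1) y (0%N, 0%N) = weight q T x.1 x.2 * (x == y)%:R.
Proof.
rewrite /lin_coef (zcoef_zdiskM q_gt0 q_lt1 rT (x.2, x.1) y) /=.
by rewrite -surjective_pairing eq_sym.
Qed.

Lemma zcoef_mul_z w m n : zcoef T w (z * zdisk q T m n) =
  up_coef q T m n * ((m.+1, n) == w)%:R
  + down_coef q T m n * ((m, n.-1) == w)%:R.
Proof.
rewrite mul_z_zdisk // cD -!(zcoef_zdisk q_gt0 q_lt1 rT).
by congr (_ + _); exact: cZ.
Qed.

Lemma zcoef_mul_zs w m n : zcoef T w (zs * zdisk q T m n) =
  up_coef_star q T m n * ((m, n.+1) == w)%:R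
  + down_coef_star q T m n * ((m.-1, n) == w)%:R.
Proof.
rewrite mul_zs_zdisk // cD -!(zcoef_zdisk q_gt0 q_lt1 rT).
by congr (_ + _); exact: cZ.
Qed.

(** R_(1,0) = z and R_(0,1) = z^*. The coefficient of R_(1,1) is (1 - T) / (1 - T Q) in z z^* and Q
    times that in z^* z. *)
Lemma lin_coef_noncomm : 1 - T != 0 ->
  lin_coef (1%N, 0%N) (0%N, 1%N) (1%N, 1%N)
  != lin_coef (0%N, 1%N) (1%N, 0%N) (1%N, 1%N).
Proof.
move=> T1; rewrite /lin_coef /=.
have z10 : zdisk q T 1 0 = z.
  by rewrite zdisk_ge // jacobi0 ?zev1 ?mulr1 //; exact: Q_neq0.
have z01 : zdisk q T 0 1 = zs.
  by rewrite zdisk_le // jacobi0 ?zev1 ?mul1r //; exact: Q_neq0.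
have e1 : zcoef T (1%N, 1%N) (z * zdisk q T 0 1) = up_coef q T 0 1.
  by rewrite zcoef_mul_z mulr1 mulr0 addr0.
have e2 : zcoef T (1%N, 1%N) (zs * z) = up_coef_star q T 1 0.
  by rewrite -z10 zcoef_mul_zs mulr1 mulr0 addr0.
rewrite z10 e1 z01 e2.
rewrite /up_coef /up_coef_star expr0 expr1 mulr1 -subr_eq0 -mulrBl.
rewrite -[X in X - _]mul1r -mulrBl !mulf_neq0 //.
  by rewrite subr_eq0 eq_sym lt_eqF // Q_lt1.
by rewrite invr_eq0; have := rT 1; rewrite expr1.
Qed.

Lemma lin_coef_unique (a : nat * nat -> nat * nat -> nat * nat -> C) :
  (forall x y : nat * nat, finite_set [set w | a x y w != 0] /\
   D x * D y = \sum_(w \in [set w | a x y w != 0]) a x y w *: D w) ->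
  a = lin_coef.
Proof.
move=> h; apply/funext => x; apply/funext => y; apply/funext => w.
have [/finite_seqP[s sE] e] := h x y.
have ms v : (v \in s) = (a x y v != 0).
  by apply/idP/idP => [vs|av]; [have : [set` s] v by []; rewrite -sE
                               |have : [set` s] v by rewrite -sE].
rewrite /lin_coef e (_ : [set w | _] = [set` undup s]); last first.
  by rewrite sE; apply/seteqP; split=> v /=; rewrite mem_undup.
rewrite -fsbig_seq ?undup_uniq // cS.
under eq_bigr do rewrite cZ zcoefE.
have [aw|aw] := eqVneq (a x y w) 0.
  rewrite aw big1_seq //= => v; rewrite mem_undup ms => av.
  by case: eqP => [vw|_]; rewrite ?mulr0 //; rewrite vw aw eqxx in av.
rewrite (bigD1_seq w) ?undup_uniq //= ?mem_undup ?ms //.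
rewrite eqxx mulr1 big1 ?addr0 // => v /negPf ->.
by rewrite mulr0.
Qed.

Lemma lin_coef_expansion x y : finite_set [set w | lin_coef x y w != 0] /\
  D x * D y = \sum_(w \in [set w | lin_coef x y w != 0]) lin_coef x y w *: D w.
Proof.
have [s us [hs e]] := lin_coef_support x y.
have sub : [set w | lin_coef x y w != 0] `<=` [set` s].
  by move=> w /= ; apply: contraNT => /hs ->.
split; first exact: sub_finite_set sub (finite_seq s).
rewrite {1}e fsbig_seq //; apply/esym/fsbig_widen => // w [_ /= /negP].
by rewrite negbK => /eqP ->; rewrite scale0r.
Qed.

End Coefs.

Lemma qpochC (a p : R) k : (qpoch a p k)%:C = qp (p%:C : C) a%:C k.
Proof.
rewrite /qpoch /qp (rmorph_prod (real_complex R)); apply: eq_bigr => j _.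
by rewrite rmorphB rmorphM rmorphXn rmorph1.
Qed.

Section DiskParam.
Variable alpha : R.

(** The number q^(2(alpha + 1)), written as U Q to fit the addition formula. *)
Definition disk_param : C := (q `^ (2 * alpha))%:C * Q.

Lemma disk_paramE : (q `^ (2 * (alpha + 1)))%:C = disk_param.
Proof.
rewrite /disk_param -rmorphM; congr (_%:C); rewrite mulrDr mulr1 powRD; last first.
  by rewrite (gt_eqF q_gt0) implybT.
by rewrite -(powR_mulrn 2) // ltW.
Qed.

Lemma jacobi_coefE a b k : (b <= a)%N ->
  (qpoch (q ^- (2 * b)) (q ^+ 2) k
   * qpoch (q `^ (2 * (alpha + (a - b)%:R + b%:R + 1))) (q ^+ 2) k
   / (qpoch (q `^ (2 * (alpha + 1))) (q ^+ 2) k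
      * qpoch (q ^+ 2) (q ^+ 2) k))%:C * Q ^+ k
  = jacobi_coef Q disk_param a b k.
Proof.
move=> ba.
have rc (x1 x2 x3 x4 : R) :
    (x1 * x2 / (x3 * x4))%:C = x1%:C * x2%:C / (x3%:C * x4%:C) :> C.
  by rewrite rmorphM fmorphV !rmorphM.
rewrite rc !qpochC disk_paramE /jacobi_coef.
have -> : (q ^- (2 * b))%:C = Q ^- b by rewrite fmorphV exprM rmorphXn.
have -> : (q `^ (2 * (alpha + (a - b)%:R + b%:R + 1)))%:C = disk_param * Q ^+ a.
  rewrite -disk_paramE -rmorphXn -rmorphM; congr (_%:C).
  rewrite -exprM -(powR_mulrn (2 * a)) ?ltW // -powRD; last first.
    by rewrite (gt_eqF q_gt0) implybT.
  by congr (_ `^ _); rewrite natrB // natrM; ring.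
by [].
Qed.

Lemma qdiskE lm : qdisk q alpha lm = zdisk q disk_param lm.1 lm.2.
Proof.
case: lm => l m; rewrite /qdisk /zdisk [_.1]/= [_.2]/=.
have h a b : (b <= a)%N -> little_qJacobi q alpha (a - b)%:R b (1 - z * zs)
    = zev q (jacobi Q disk_param a b).
  move=> ba; rewrite /little_qJacobi /jacobi zev_poly; apply: eq_bigr => k _.
  by rewrite exprZn scalerA -zxE jacobi_coefE.
by case: leqP => [ml|lm]; rewrite h // ltnW.
Qed.

End DiskParam.
End Linearization.

(** * Finitely supported measures on a discrete space *)

Section DiscreteMeasures.
Context (R : realType) (K : ptopologicalType).
Hypothesis dK : discrete_space K.

Lemma discrete_borel (E : set (borel K)) : measurable E.
Proof. by apply: sub_sigma_algebra; exact: dK. Qed.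

Lemma discrete_nbhs (x : K) : nbhs x [set x].
Proof. by apply: open_nbhs_nbhs; split=> //; exact: dK. Qed.

Lemma discrete_continuous (T : topologicalType) (f : K -> T) : continuous f.
Proof.
move=> x A /nbhs_singleton Ax; apply: filterS (discrete_nbhs x) => y /= ->.
exact: Ax.
Qed.

Lemma discrete_continuous2 (T : topologicalType) (f : K * K -> T) : continuous f.
Proof.
move=> -[x y] A /nbhs_singleton Ax.
exists ([set x], [set y]); first by split; exact: discrete_nbhs.
by move=> [x' y'] /= [-> ->]; exact: Ax.
Qed.

Section FiniteMeasure.
Variables (s : seq K) (c : K -> {nonneg R}).

Definition fin_measure : set (borel K) -> \bar R :=
  msum (fun i => mscale (c (nth point s i))
                        (@dirac _ (borel K) (nth point s i) R)) (size s).

HB.instance Definition _ := Measure.on fin_measure.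

Lemma fin_measureE E :
  fin_measure E = (\sum_(w <- s) (c w)%:num * (w \in E)%:R)%:E.
Proof.
rewrite /fin_measure /msum (big_nth point) big_mkord -sumEFin.
by apply: eq_bigr => i _; rewrite EFinM.
Qed.

Lemma integral_fin_measure (f : borel K -> \bar R) : (forall x, 0 <= f x)%E ->
  (\int[fin_measure]_x f x = \sum_(w <- s) (c w)%:num%:E * f w)%E.
Proof.
move=> f0; rewrite /fin_measure ge0_integral_measure_sum //; last first.
  by move=> _ B _; exact: discrete_borel.
rewrite (big_nth point) big_mkord; apply: eq_bigr => i _.
rewrite ge0_integral_mscale //; last by move=> _ B _; exact: discrete_borel.
rewrite integral_dirac //; last by move=> _ B _; exact: discrete_borel.
by rewrite diracT mul1e.
Qed.

End FiniteMeasure.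

Section FiniteProbability.
Variables (s : seq K) (c : K -> {nonneg R}).
Hypothesis c1 : \sum_(w <- s) (c w)%:num = 1.

(* The proof is an argument because the probability instance depends on it. *)
Definition fin_prob (_ : \sum_(w <- s) (c w)%:num = 1) := fin_measure s c.

HB.instance Definition _ h := Measure.on (fin_prob h).

Lemma fin_prob_setT h : fin_prob h setT = 1%E.
Proof.
rewrite /fin_prob fin_measureE -[X in _ = X%:E]c1; congr (_%:E).
by apply: eq_bigr => w _; rewrite in_setT mulr1.
Qed.

HB.instance Definition _ h :=
  @Measure_isProbability.Build _ _ R (fin_prob h) (fin_prob_setT h).

Lemma fin_prob_regular h : regular_measure (fin_prob h).
Proof.
move=> E _; split; apply/eqP; rewrite eq_le; apply/andP; split.
- apply: le_ereal_inf_tmp => _ [U [_ EU] <-].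
  by apply: le_measure => //; rewrite inE; exact: discrete_borel.
- by apply: ereal_inf_lbound; exists E => //; split=> //; exact: dK.
(* The part of E inside the finite list is compact and carries all of the mass of E. *)
- apply: ereal_sup_ubound; exists (E `&` [set` s]).
    split; last by move=> x [].
    apply: finite_compact; apply: sub_finite_set (finite_seq s).
    by move=> x [].
  rewrite /fin_prob !fin_measureE; congr (_%:E); rewrite big_seq [RHS]big_seq.
  apply: eq_bigr => w ws.
  by rewrite in_setI (_ : w \in [set` s]) ?andbT // inE.
- apply: ge_ereal_sup => _ [C [_ CE] <-].
  by apply: le_measure => //; rewrite inE; exact: discrete_borel.
Qed.

Definition fin_regular : regular_probability R K :=
  RegularProbability (fin_prob_regular c1).

End FiniteProbability.
End DiscreteMeasures.

(** * The hypergroup *)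

Section Hypergroup.
Context (R : realType) (q alpha : R).
Hypotheses (q_gt0 : 0 < q) (q_lt1 : q < 1) (alpha_gt0 : 0 < alpha).
Local Notation C := R[i].
Local Notation Q := ((q ^+ 2)%:C : C).
Local Notation U := ((q `^ (2 * alpha))%:C : C).
Local Notation T := (disk_param q alpha).
Local Notation K := (qdisk_space : ptopologicalType).

Lemma disk_param_bounds : 0 < U /\ U < 1.
Proof.
split; first by rewrite ltcR powR_gt0.
have -> : (1 : C) = (1 `^ (2 * alpha))%:C by rewrite powR1.
rewrite ltcR gt0_ltr_powR //.
- by rewrite mulr_gt0.
- by rewrite nnegrE ltW.
- by rewrite nnegrE.
Qed.

Lemma disk_param_gt0 : 0 < T.
Proof.
by have [U0 _] := disk_param_bounds; rewrite mulr_gt0 // Q_gt0.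
Qed.

Lemma disk_param_lt1 : T < 1.
Proof.
have [U0 U1] := disk_param_bounds; rewrite (lt_trans _ U1) //.
by rewrite gtr_pMr // Q_lt1.
Qed.

Lemma regular_disk_param : regular Q T.
Proof.
by apply: regular_lt1 => //; [exact/ltW/disk_param_gt0|exact: disk_param_lt1].
Qed.

Local Notation rT := regular_disk_param.
Local Notation a := (@lin_coef R q T).

Lemma lin_coef_ge0 x y w : 0 <= a x y w.
Proof.
by have [U0 U1] := disk_param_bounds; exact: zcoef_mul_ge0.
Qed.

(** Nonnegativity in R[i] includes a zero imaginary part, so the real part loses nothing. *)
Definition mass (x y w : nat * nat) : R := complex.Re (a x y w).

Lemma massE x y w : (mass x y w)%:C = a x y w.
Proof.
have := lin_coef_ge0 x y w; rewrite lecE /mass; case: (a x y w) => r i /=.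
by case/andP => /eqP -> _.
Qed.

Lemma mass_ge0 x y w : 0 <= mass x y w.
Proof. by have := lin_coef_ge0 x y w; rewrite lecE => /andP[]. Qed.

Lemma mass_inj (r r' : R) : r%:C = r'%:C :> C -> r = r'.
Proof. by case. Qed.

Lemma mass_eq0 x y w : (mass x y w == 0) = (a x y w == 0).
Proof. by rewrite -massE fmorph_eq0. Qed.

Definition nonneg_mass x y w : {nonneg R} := NngNum (mass_ge0 x y w).

Lemma mass_supportP x y : exists s : seq (nat * nat), uniq s /\
  forall w, w \notin s -> a x y w = 0.
Proof.
by have [s us [hs _]] := lin_coef_support q_gt0 q_lt1 rT x y; exists s.
Qed.

Definition mass_support x y : seq K := sval (cid (mass_supportP x y)).

Lemma mass_support_uniq x y : uniq (mass_support x y).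
Proof. by rewrite /mass_support; case: cid => s []. Qed.

Lemma mass_support0 x y w : w \notin mass_support x y -> mass x y w = 0.
Proof.
rewrite /mass_support; case: cid => s [us hs] /= ws.
by apply/eqP; rewrite mass_eq0 hs.
Qed.

Lemma sum_mass (s : seq (nat * nat)) x y (f : nat * nat -> R) : uniq s ->
  (forall w, w \notin s -> mass x y w = 0) ->
  \sum_(w <- mass_support x y) mass x y w * f w = \sum_(w <- s) mass x y w * f w.
Proof.
move=> us hs.
rewrite (bigID (mem s)) /= [X in _ + X]big1 ?addr0; last first.
  by move=> w ws; rewrite hs // mul0r.
rewrite [RHS](bigID (mem (mass_support x y))) /= [X in _ = _ + X]big1 ?addr0;
  last by move=> w ws; rewrite mass_support0 // mul0r.
rewrite -big_filter -[RHS]big_filter; apply: perm_big; apply: uniq_perm.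
- by rewrite filter_uniq // mass_support_uniq.
- by rewrite filter_uniq.
- by move=> w; rewrite !mem_filter andbC.
Qed.

Lemma sum_mass1 x y : \sum_(w <- mass_support x y) (nonneg_mass x y w)%:num = 1.
Proof.
apply: mass_inj; rewrite rmorph_sum rmorph1 /=.
rewrite -(@lin_coef_sum1 _ _ q_gt0 q_lt1 _ rT x y (mass_support x y)).
- by apply: eq_bigr => w _; exact: massE.
- exact: mass_support_uniq.
- by move=> w /mass_support0 /eqP; rewrite mass_eq0 => /eqP.
Qed.

Lemma discrete_K : discrete_space K.
Proof. exact: discrete_open. Qed.

Definition star (x y : K) : regular_probability R K :=
  fin_regular discrete_K (sum_mass1 x y).

Lemma starE x y E :
  star x y E = (\sum_(w <- mass_support x y) mass x y w * (w \in E)%:R)%:E.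
Proof. exact: fin_measureE. Qed.

Lemma starE' x y E (s : seq (nat * nat)) : uniq s ->
  (forall w, w \notin s -> mass x y w = 0) ->
  star x y E = (\sum_(w <- s) mass x y w * (w \in E)%:R)%:E.
Proof. by move=> us hs; rewrite starE (sum_mass _ us hs). Qed.

Lemma star_set1 x y w : star x y [set w] = (mass x y w)%:E.
Proof.
set s := undup (w :: mass_support x y).
have ws : w \in s by rewrite mem_undup inE eqxx.
have hs v : v \notin s -> mass x y v = 0.
  by rewrite mem_undup inE negb_or => /andP[_]; exact: mass_support0.
rewrite (starE' _ (undup_uniq _) hs) (bigD1_seq w) ?undup_uniq //=.
rewrite mem_set // mulr1 big1 ?addr0 // => v /eqP vw.
by rewrite memNset ?mulr0.
Qed.

Lemma msuppE x y w : msupp (star x y) w <-> a x y w != 0.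
Proof.
have pos : (0 < mass x y w) = (a x y w != 0).
  by rewrite lt0r mass_ge0 andbT mass_eq0.
split=> [h|aw V _ Vw].
  suff : (0 < star x y [set w])%E by rewrite star_set1 lte_fin pos.
  by apply: h; first exact: discrete_K.
have : (star x y [set w] <= star x y V)%E.
  apply: le_measure; rewrite ?inE; [exact: (discrete_borel discrete_K)..|].
  by move=> _ ->.
by apply: lt_le_trans; rewrite star_set1 lte_fin pos.
Qed.

Local Notation inv := (fun lm : K => ((lm.2, lm.1) : K)).

Lemma msupp_finite x y : finite_set (msupp (star x y)).
Proof.
apply: sub_finite_set (finite_seq (mass_support x y)) => w /msuppE /=.
by apply: contraNT => /mass_support0 /eqP; rewrite mass_eq0.
Qed.

Lemma msupp_neq0 x y : msupp (star x y) !=set0.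
Proof.
apply: contrapT => h; have := sum_mass1 x y; rewrite big1.
  by move=> /eqP; rewrite eq_sym oner_eq0.
move=> w _; apply/eqP; rewrite [_ == _]mass_eq0; apply: contrapT => /negP aw.
by apply: h; exists w; apply/msuppE.
Qed.

Lemma integral_star x y (f : borel K -> \bar R) : (forall v, 0 <= f v)%E ->
  (\int[star x y]_v f v
   = \sum_(v <- mass_support x y) (mass x y v)%:E * f v)%E.
Proof. by move=> f0; exact: (integral_fin_measure discrete_K). Qed.

Lemma integral_dirac_K w (f : borel K -> \bar R) :
  (\int[@dirac _ (borel K) w R]_v f v = f w)%E.
Proof.
rewrite integral_dirac ?diracT ?mul1e //.
by move=> _ B _; exact: (discrete_borel discrete_K).
Qed.

Lemma star_assoc x y w :
  measure_eq (mconv star (@dirac _ (borel K) x R) (star y w))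
             (mconv star (star x y) (@dirac _ (borel K) w R)).
Proof.
move=> E _; rewrite /mconv.
rewrite [LHS]integral_dirac_K integral_star; last by move=> v; exact: measure_ge0.
rewrite [RHS]integral_star; last first.
  by move=> v; rewrite integral_dirac_K; exact: measure_ge0.
(* One list containing all supports that occur, so that both sides become sums over the same
   indices. *)
pose s := undup (flatten [seq mass_support x v | v <- mass_support y w] ++
                 flatten [seq mass_support v w | v <- mass_support x y]).
have us : uniq s by exact: undup_uniq.
have hl v : v \in mass_support y w ->
    star x v E = (\sum_(u <- s) mass x v u * (u \in E)%:R)%:E.
  move=> vs; apply: starE' => // u; apply: contraNeq => m0.
  rewrite mem_undup mem_cat; apply/orP; left; apply/flattenP.
  exists (mass_support x v); first by rewrite map_f.
  by apply: contraNT m0 => /mass_support0 ->.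
have hr v : v \in mass_support x y ->
    star v w E = (\sum_(u <- s) mass v w u * (u \in E)%:R)%:E.
  move=> vs; apply: starE' => // u; apply: contraNeq => m0.
  rewrite mem_undup mem_cat; apply/orP; right; apply/flattenP.
  exists (mass_support v w); first by apply/mapP; exists v.
  by apply: contraNT m0 => /mass_support0 ->.
transitivity ((\sum_(u <- s)
    (\sum_(v <- mass_support y w) mass y w v * mass x v u) * (u \in E)%:R)%:E).
  rewrite big_seq (eq_bigr _ (fun v vs => congr1 _ (hl v vs))) -big_seq.
  under eq_bigr do rewrite -EFinM mulr_sumr.
  rewrite sumEFin exchange_big /=; congr (_%:E); apply: eq_bigr => u _.
  by rewrite mulr_suml; apply: eq_bigr => v _; rewrite mulrA.
transitivity ((\sum_(u <- s)
    (\sum_(v <- mass_support x y) mass x y v * mass v w u) * (u \in E)%:R)%:E).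
  congr (_%:E); apply: eq_bigr => u _; congr (_ * _); apply: mass_inj.
  rewrite !rmorph_sum /=.
  transitivity (\sum_(v <- mass_support y w) a y w v * a x v u).
    by apply: eq_bigr => v _; rewrite rmorphM -!massE.
  rewrite (lin_coef_assoc q_gt0 q_lt1 rT u (mass_support_uniq y w)
    (mass_support_uniq x y)).
  - by apply: eq_bigr => v _; rewrite rmorphM -!massE.
  - by move=> v /mass_support0 /eqP; rewrite mass_eq0 => /eqP.
  - by move=> v /mass_support0 /eqP; rewrite mass_eq0 => /eqP.
rewrite [RHS]big_seq; under [RHS]eq_bigr => v vs do rewrite integral_dirac_K hr //.
rewrite -[RHS]big_seq.
under [RHS]eq_bigr do rewrite -EFinM mulr_sumr.
rewrite sumEFin exchange_big /=; congr (_%:E); apply: eq_bigr => u _.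
by rewrite mulr_suml; apply: eq_bigr => v _; rewrite mulrA.
Qed.

Lemma star_inv x y :
  measure_eq (minv inv (star x y)) (star (inv y) (inv x)).
Proof.
move=> E _; rewrite /minv starE.
have inj : injective inv by move=> [m n] [m' n'] /= [-> ->].
have mi w : mass (inv y) (inv x) (inv w) = mass x y w.
  by apply: mass_inj; rewrite !massE (lin_coef_inv q_gt0 q_lt1 rT).
rewrite (@starE' _ _ _ [seq inv w | w <- mass_support x y]).
- rewrite big_map; congr (_%:E); apply: eq_bigr => w _; rewrite mi.
  congr (_ * (nat_of_bool _)%:R); apply/idP/idP; rewrite !inE.
    by move=> [[m n] Emn <-].
  by move=> Ew; exists (inv w) => //; case: (w).
- by rewrite map_inj_uniq // mass_support_uniq.
- move=> w ws; rewrite -(_ : inv (inv w) = w); last by case: (w).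
  rewrite mi mass_support0 //; apply: contraNN ws => ws.
  by apply/mapP; exists (inv w) => //; case: (w).
Qed.

Lemma star_point x y w0 : (forall w, a x y w = (w0 == w)%:R) ->
  measure_eq (star x y) (@dirac _ (borel K) w0 R).
Proof.
move=> h E _; have mE w : mass x y w = (w0 == w)%:R.
  by apply: mass_inj; rewrite massE h; case: eqP => _; rewrite ?rmorph1 ?rmorph0.
rewrite (@starE' _ _ _ [:: w0]) //; last first.
  by move=> w; rewrite inE mE eq_sym => /negPf ->.
by rewrite big_seq1 mE eqxx mul1r diracE.
Qed.

Lemma star_hypergroup : DJS_hypergroup star inv ((0%N, 0%N) : K).
Proof.
split.
- move=> x _; exists [set x]; last first.
    split; first exact: compact_set1.
    exact: discrete_closed.
  exact: (filterS _ (discrete_nbhs discrete_K x)).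
- exact: (@discrete_hausdorff qdisk_space).
- exact: (discrete_continuous2 discrete_K).
- by case.
- exact: (discrete_continuous discrete_K).
- exact: star_assoc.
- by move=> x y; apply/finite_compact/msupp_finite.
- exact: star_inv.
- move=> x; split; apply: star_point => w.
    exact: (lin_coef_unitl q_gt0 q_lt1 rT).
  exact: (lin_coef_unitr q_gt0 q_lt1 rT).
- move=> x y.
  (* The mass at e of the product of the conjugate of x with y is the squared norm of R_x if x = y,
     and 0 otherwise. *)
  have w0 : weight q T x.1 x.2 != 0.
    by rewrite gt_eqF // weight_gt0 ?disk_param_gt0 ?disk_param_lt1.
  split=> [/msuppE|<-]; last first.
    by apply/msuppE; rewrite (lin_coef_unit q_gt0 q_lt1 rT) eqxx mulr1.
  rewrite (lin_coef_unit q_gt0 q_lt1 rT) mulf_eq0 negb_or w0 pnatr_eq0 eqb0.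
  by rewrite negbK => /eqP.
- exists (fun xy => CompactSubset (finite_compact (msupp_finite xy.1 xy.2))
                                  (msupp_neq0 xy.1 xy.2)) => //.
  exact: (discrete_continuous2 discrete_K).
Qed.

Lemma star_noncommutative : ~ commutative_hypergroup star.
Proof.
move=> /(_ (1%N, 0%N) (0%N, 1%N) [set (1%N, 1%N)] (discrete_borel discrete_K _)).
rewrite !star_set1 => -[e]; have := lin_coef_noncomm q_gt0 q_lt1 rT.
have T1 : 1 - T != 0 by rewrite subr_eq0 gt_eqF // disk_param_lt1.
by move=> /(_ T1); rewrite -!massE e eqxx.
Qed.

End Hypergroup.

Theorem theorem5 (R : realType) (q alpha : R)
    (q_gt0 : 0 < q) (q_lt1 : q < 1) (alpha_gt0 : 0 < alpha) :
  let K : ptopologicalType := qdisk_space in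
  let inv : K -> K := fun lm => (lm.2, lm.1) in
  let e : K := (0%N, 0%N) in
  exists a : nat * nat -> nat * nat -> nat * nat -> R[i],
    unique (qdisk_linearization q alpha) a /\
    exists star : K -> K -> regular_probability R K,
      [/\ forall x y w : K, (fine (star x y [set w]))%:C = a x y w,
          DJS_hypergroup star inv e,
          ~ commutative_hypergroup star
        & discrete_space K].
Proof.
move=> K inv e; have rT := regular_disk_param q_gt0 q_lt1 alpha_gt0.
exists (@lin_coef R q (disk_param q alpha)); split.
  have E : qdisk q alpha = fun lm => zdisk q (disk_param q alpha) lm.1 lm.2.
    by apply/funext => lm; exact: qdiskE.
  rewrite /qdisk_linearization E; split=> [x y|a' h].
    exact: (lin_coef_expansion q_gt0 q_lt1 rT).
  exact/esym/(lin_coef_unique q_gt0 q_lt1 rT).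
exists (star q_gt0 q_lt1 alpha_gt0); split.
- by move=> x y w; rewrite star_set1 /= massE.
- exact: star_hypergroup.
- exact: star_noncommutative.
- exact: discrete_K.
Qed.
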